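(* Let $B_n\in\Omega_n$ be a polyomino chain having $n\geq 3$ squares. (1) If $TI$ is one of the following indices: the first geometric-arithmetic index $\sum_{uv\in E(G)}\frac{2\sqrt{d_ud_v}}{d_u+d_v}$, the Randić index $\sum_{uv\in E(G)}\frac{1}{\sqrt{d_ud_v}}$, the sum-connectivity index $\sum_{uv\in E(G)}\frac{1}{\sqrt{d_u+d_v}}$, then $$TI(Z_n)\leq TI(B_n)\leq TI(L_n),$$ with right (respectively left) equality if and only if $B_n\cong L_n$ (respectively $B_n\cong Z_n$). (2) For the multiplicative sum Zagreb index $\Pi_1^{*}(G)=\prod_{uv\in E(G)}(d_u+d_v)$ and the multiplicative second Zagreb index $\Pi_2(G)=\prod_{uv\in E(G)}d_ud_v$, the following inequalities hold: $$\Pi_1^{*}(L_n)\leq \Pi_1^{*}(B_n)\leq \Pi_1^{*}(Z_n),$$ $$\Pi_2(L_n)\leq \Pi_2(B_n)\leq \Pi_2(Z_n),$$ with left (respectively right) equalities if and only if $B_n\cong L_n$ (respectively $B_n\cong Z_n$).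
   Context: A polyomino system is a finite 2-connected plane graph in which each interior face is a regular (unit) square of side length one. Two squares are adjacent if they share an edge. A polyomino chain is a polyomino system in which every square is adjacent to at most two squares; its squares form a sequence $C_1,\dots,C_n$ in which exactly consecutive squares are adjacent. A square adjacent to only one other square is terminal; a square adjacent to two other squares is non-terminal. A kink is a non-terminal square having a vertex of degree 2 (degrees are taken in the graph of the chain). The linear chain $L_n$ is the polyomino chain with $n$ squares without kinks. The zigzag chain $Z_n$ is the polyomino chain with $n$ squares consisting only of kinks and terminal squares. A segment is a maximal linear chain in a polyomino chain, including the kinks and/or terminal squares at its ends; its length is its number of squares. The segments of a chain are listed in order along the chain as $S_1,\dots,S_s$, consecutive ones sharing exactly one square (a kink); $S_1,S_s$ are external, and $S_i$ with $2\le i\le s-1$ are internal. $\Omega_n$ denotes the collection of all polyomino chains with $n$ squares in which no internal segment of length three has an edge connecting two vertices of degree three. For a graph $G$, $E(G)$ is its edge set and $d_u$ is the degree of the vertex $u$. *)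

(* Defs.v *)
From mathcomp Require Import all_boot all_order all_algebra.
From mathcomp Require Import reals.

Set Implicit Arguments.
Unset Strict Implicit.
Unset Printing Implicit Defensive.

Import Order.TTheory GRing.Theory Num.Theory.

Local Open Scope ring_scope.

Record sgraph := SGraph {
  vertex :> finType;
  adj : rel vertex;
  adj_sym : symmetric adj;
  adj_irr : irreflexive adj }.

Definition deg (G : sgraph) (x : G) : nat := #|[set y | adj x y]|.

Definition edges (G : sgraph) : {set {set G}} :=
  [set e | [exists x, [exists y, adj x y && (e == [set x; y])]]].

Definition two_connected (G : sgraph) : Prop :=
  [/\ (2 < #|G|)%N,
      forall x y : G, connect (@adj G) x y
    & forall v x y : G, x != v -> y != v ->
        connect [rel a b | [&& adj a b, a != v & b != v]] x y].

Definition isomorphic (G H : sgraph) : Prop :=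
  exists2 f : G -> H, bijective f & forall x y, adj (f x) (f y) = adj x y.

(* For an edge e = {u, v}: d_u + d_v and d_u d_v. *)
Definition dsum (G : sgraph) (e : {set G}) : nat := (\sum_(x in e) deg x)%N.
Definition dprod (G : sgraph) (e : {set G}) : nat := (\prod_(x in e) deg x)%N.

Definition GA_index (R : realType) (G : sgraph) : R :=
  \sum_(e in edges G) (2 * Num.sqrt (dprod e)%:R) / (dsum e)%:R.

Definition Randic_index (R : realType) (G : sgraph) : R :=
  \sum_(e in edges G) 1 / Num.sqrt (dprod e)%:R.

Definition sum_connectivity_index (R : realType) (G : sgraph) : R :=
  \sum_(e in edges G) 1 / Num.sqrt (dsum e)%:R.

Definition mult_sum_Zagreb (G : sgraph) : nat :=
  (\prod_(e in edges G) dsum e)%N.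

Definition mult_second_Zagreb (G : sgraph) : nat :=
  (\prod_(e in edges G) dprod e)%N.

(* Up to a rigid motion, a 2-connected plane graph whose interior faces are
   unit squares is drawn on the integer lattice, its edges being unit lattice
   segments; such a drawing has no crossings. *)
Definition point := (int * int)%type.

Definition lattice_adj (p q : point) : bool :=
  `|p.1 - q.1| + `|p.2 - q.2| == 1.

Record lattice_graph := LatticeGraph {
  graph :> sgraph;
  pos : graph -> point;
  pos_inj : injective pos;
  pos_adj : forall x y : graph, adj x y -> lattice_adj (pos x) (pos y) }.

(* A unit cell of the lattice is named by its lower left corner; the corners
   are listed in cyclic order. *)
Definition cell := point.

Definition corners (c : cell) : seq point :=
  [:: c; (c.1 + 1, c.2); (c.1 + 1, c.2 + 1); (c.1, c.2 + 1)].

Section Drawing.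

Variable G : lattice_graph.

Definition drawn (p q : point) : bool :=
  [exists x : G, [exists y : G, [&& adj x y, pos x == p & pos y == q]]].

Definition vertex_of (c : cell) (x : G) : bool := pos x \in corners c.

Definition edge_of (c : cell) (x y : G) : bool :=
  [&& adj x y, vertex_of c x & vertex_of c y].

Definition share_edge (c d : cell) : bool :=
  [exists x : G, [exists y : G, edge_of c x y && edge_of d x y]].

Definition square (c : cell) : bool := cycle drawn (corners c).

Definition adjacent (c d : cell) : bool := (c != d) && share_edge c d.

(* The faces of the drawing: two cells lie in the same face when one can walk
   from one to the other through common sides that are not edges of G. *)
Definition open_step (c d : cell) : bool :=
  lattice_adj c d && ~~ share_edge c d.

Definition same_face (c d : cell) : Prop :=
  exists2 s : seq cell, path open_step c s & last c s = d.

Definition interior_face (c : cell) : Prop :=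
  exists N : int, forall d, same_face c d -> `|d.1| <= N /\ `|d.2| <= N.

Definition polyomino_system : Prop :=
  two_connected G /\ forall c, interior_face c -> square c.

Definition polyomino_chain (n : nat) (C : seq cell) : Prop :=
  [/\ polyomino_system,
      size C = n, uniq C,
      forall c, (c \in C) = square c
    & forall i j, (i < n)%N -> (j < n)%N ->
        adjacent C`_i C`_j = (j == i.+1) || (i == j.+1)].

Definition terminal (C : seq cell) (c : cell) : Prop :=
  c \in C /\ count (adjacent c) C = 1%N.

Definition nonterminal (C : seq cell) (c : cell) : Prop :=
  c \in C /\ count (adjacent c) C = 2%N.

Definition kink (C : seq cell) (c : cell) : Prop :=
  nonterminal C c /\ exists2 x : G, vertex_of c x & deg x = 2%N.

(* C`_a, ..., C`_b is a linear chain: its non-terminal squares, which are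
   those strictly between its ends, are not kinks. *)
Definition linear_run (C : seq cell) (a b : nat) : Prop :=
  (a <= b < size C)%N /\ forall i, (a < i < b)%N -> ~ kink C C`_i.

Definition segment (C : seq cell) (a b : nat) : Prop :=
  linear_run C a b /\
  forall a' b', (a' <= a)%N -> (b <= b')%N -> linear_run C a' b' ->
    a' = a /\ b' = b.

(* The first and last segments are those containing the first and the last
   square of the chain. *)
Definition internal_segment (C : seq cell) (a b : nat) : Prop :=
  [/\ segment C a b, (0 < a)%N & (b.+1 < size C)%N].

Definition segment_length (a b : nat) : nat := (b - a).+1.

Definition Omega (n : nat) : Prop :=
  exists2 C, polyomino_chain n C &
    forall a b, internal_segment C a b -> segment_length a b = 3%N ->
      ~ exists i, exists x : G, exists y : G,
          [/\ (a <= i <= b)%N, edge_of C`_i x y, deg x = 3%N & deg y = 3%N].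

Definition linear_chain (n : nat) : Prop :=
  exists2 C, polyomino_chain n C & forall c, c \in C -> ~ kink C c.

Definition zigzag_chain (n : nat) : Prop :=
  exists2 C, polyomino_chain n C &
    forall c, c \in C -> kink C c \/ terminal C c.

End Drawing.

(* Main.v *)
Require Import Defs.
From mathcomp Require Import all_boot all_order all_algebra.
From mathcomp Require Import reals.
From mathcomp Require Import ssrAC zify ring lra.

Import Order.TTheory GRing.Theory Num.Theory.

Local Open Scope ring_scope.

Set Implicit Arguments.
Unset Strict Implicit.
Unset Printing Implicit Defensive.

(** The graph of a polyomino chain is determined, up to isomorphism, by the way
    its squares turn, and each of the five indices only depends on which
    squares turn as long as the chain is in the family Omega.

    _Gluing_.  Bounded faces are squares, so a chain encloses no hole, and each
    square C_j meets the union of its predecessors in exactly the side that it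
    shares with C_{j-1} ([far_corner_new]).  The proof is a discrete Jordan
    argument.  A closed walk gives each cell the parity of its crossings with a
    horizontal ray from that cell.  The parity changes precisely across the
    sides that the walk uses an odd number of times ([winding_side]), so cells
    of odd parity lie in bounded faces and are squares ([encircled_square]).
    A far corner of C_j on an earlier square would yield a closed walk that
    makes C_j or C_{j+1} odd, and the oddness would spread to more neighbours
    than a square of a chain has.

    _Ladders_.  Hence every square adds two vertices and three edges, and the
    graph is a ladder ([ladder], [chain_ladder]) whose data are the squares
    [k] at which the chain turns and the squares [f] after which the names of
    its two sides are swapped, so that the next pivot always comes first.
    Degrees are explicit in [k] ([ladder_deg]); in particular turns are kinks.
    The condition that defines Omega forces opposite directions on two turns
    separated by a single straight square, so no swap follows a turn directly
    ([flip_regular]).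

    _Indices_.  Under this condition an index, read in its commutative monoid
    (sums of reals or products of naturals), is a combination of terms that
    each involve two consecutive turns, together with one term for each end
    ([ladder_index]).  For all five indices every such term strictly moves in
    the same direction when a turn is added ([turning_decreases]).  So the
    ladder without turns and the ladder with all turns are extremal
    ([turn_lowers_index], [index_between]).  In the case of equality the turns
    agree, no names are swapped, and ladders with equal data are isomorphic
    ([ladder_isomorphic]). *)

(** * Winding parity of closed lattice walks *)

Lemma cornersE (c x : point) :
  (x \in corners c) = (c.1 <= x.1 <= c.1 + 1) && (c.2 <= x.2 <= c.2 + 1).
Proof.
case: c x => [c1 c2] [x1 x2]; rewrite /corners !inE /= !xpair_eqE /=; lia.
Qed.

Lemma lattice_adjP (p q : point) : lattice_adj p q ->
  [\/ q = (p.1 + 1, p.2), q = (p.1 - 1, p.2), q = (p.1, p.2 + 1) | q = (p.1, p.2 - 1)].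
Proof.
case: p q => [p1 p2] [q1 q2]; rewrite /lattice_adj /= => h.
have : [|| (q1 == p1 + 1) && (q2 == p2), (q1 == p1 - 1) && (q2 == p2), (q1 == p1) && (q2 == p2 + 1)
  | (q1 == p1) && (q2 == p2 - 1)] by lia.
by case/or4P => /andP[/eqP-> /eqP->]; [constructor 1|constructor 2|constructor 3|constructor 4].
Qed.

Lemma lattice_adj_sym : symmetric lattice_adj.
Proof. by move=> p q; rewrite /lattice_adj distrC [X in _ + X]distrC. Qed.

(** The ray leaves the centre of [c] to the right.  Its height is half-integral,
    so it avoids the lattice points and only meets vertical steps. *)
Definition ray_crosses (c : cell) (e : point * point) : bool :=
  (c.1 < e.1.1) && ((e.1.2 <= c.2) (+) (e.2.2 <= c.2)).
Definition on_side (c d : cell) (e : point * point) : bool :=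
  [&& e.1 \in corners c, e.2 \in corners c, e.1 \in corners d & e.2 \in corners d].

(** The lattice points that the ray of [c] sweeps over when it is moved onto the
    ray of [d]; there are none when the two cells are side by side. *)
Definition upper_ray (c d : cell) (z : point) : bool :=
  [&& c.2 != d.2, c.1 < z.1 & z.2 == Num.max c.2 d.2].
Definition boundary T (S : pred T) (e : T * T) : bool := S e.1 (+) S e.2.

(** Moving the ray from [c] to [d] changes whether it meets a step in two cases
    only: the step is the common side, or it has exactly one end among the
    points swept over. *)
Lemma ray_step (c d x y : point) : lattice_adj c d -> lattice_adj x y ->
  on_side c d (x, y) = ray_crosses c (x, y) (+) ray_crosses d (x, y)
                         (+) boundary (upper_ray c d) (x, y).
Proof.
case: c d x y => [c1 c2] d [x1 x2] y /lattice_adjP D /lattice_adjP E /=.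
rewrite /boundary /upper_ray /ray_crosses /on_side !cornersE.
by case: D => -> /=; case: E => -> /=; lia.
Qed.

Definition steps T (x : T) (s : seq T) := pairmap pair x s.

Lemma odd_count_addb T (a b : pred T) s :
  odd (count (fun x => a x (+) b x) s) = odd (count a s) (+) odd (count b s).
Proof.
elim: s => //= x s IH; rewrite !oddD IH !oddb.
by case: (a x) (b x) (odd _) (odd _) => [] [] [] [].
Qed.

(** Every passage between [S] and its complement flips the membership in [S]. *)
Lemma odd_boundary T (S : pred T) x s :
  odd (count (boundary S) (steps x s)) = S x (+) S (last x s).
Proof.
elim: s x => [|y s IH] x /=; first by rewrite addbb.
by rewrite oddD oddb IH /boundary /= addbA -(addbA (S x)) addbb addbF.
Qed.

Definition winding (c : cell) (x : point) (s : seq point) : bool :=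
  odd (count (ray_crosses c) (steps x s)).

(** A closed walk enters the swept points as often as it leaves them, so only
    its passages along the common side matter. *)
Lemma winding_side c d x s : lattice_adj c d -> path lattice_adj x s ->
  last x s = x ->
  odd (count (on_side c d) (steps x s)) = winding c x s (+) winding d x s.
Proof.
move=> cd xs closed.
have -> : count (on_side c d) (steps x s) = count (fun e => ray_crosses c e
    (+) ray_crosses d e (+) boundary (upper_ray c d) e) (steps x s).
  elim: s x xs {closed} => //= y s IH x /andP[xy ys].
  by rewrite (IH y ys) (ray_step cd xy).
by rewrite odd_count_addb odd_count_addb odd_boundary closed addbb addbF.
Qed.

Lemma mem_steps (T : eqType) (x : T) s e : e \in steps x s ->
  (e.1 \in x :: s) && (e.2 \in x :: s).
Proof.
elim: s x => //= y s IH x; rewrite inE => /predU1P[-> | /IH]; first by rewrite /= !inE !eqxx orbT.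
by case/andP; rewrite !in_cons => -> ->; rewrite !orbT.
Qed.

(** Above, below and to the right of the walk the ray misses it.  To the left of
    it the ray meets the walk as often as the whole horizontal line does, which
    is an even number of times. *)
Lemma winding_bounded c (x : point) (s : seq point) (N : int) : last x s = x ->
  (forall y : point, y \in x :: s -> `|y.1| <= N /\ `|y.2| <= N) ->
  winding c x s -> `|c.1| <= N /\ `|c.2| <= N.
Proof.
move=> closed bnd w.
have /hasP[e /mem_steps/andP[/bnd b1 /bnd b2]] : has (ray_crosses c) (steps x s).
  by rewrite has_count; move: w; rewrite /winding; case: (count _ _).
rewrite /ray_crosses => ce.
have /hasP[z /bnd b3 /= zc] : has (fun z : point => z.1 <= c.1) (x :: s).
  apply: contraTT w => /hasPn right; rewrite /winding.
  have -> : count (ray_crosses c) (steps x s) =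
      count (boundary (fun z : point => z.2 <= c.2)) (steps x s).
    apply: eq_in_count => f /mem_steps/andP[/right].
    by rewrite -ltNge /ray_crosses => -> _.
  by rewrite odd_boundary closed addbb.
move: ce b1 b2 b3 zc; case: e z => [[e1 e2] [f1 f2]] [z1 z2] /= ce [? ?] [? ?] [? ?] zc.
by lia.
Qed.

Section Graph.
Variable G : lattice_graph.
Local Notation adjG := (@adj G).
Definition encircled (x : G) s c := winding c (pos x) (map (@pos G) s).

Lemma pos_path (x : G) s :
  path adjG x s -> path lattice_adj (pos x) (map (@pos G) s).
Proof. elim: s x => //= y s IH x /andP[xy ys]. by rewrite (pos_adj xy) IH. Qed.

Lemma path_steps (T : eqType) (e : rel T) (x : T) s :
  path e x s = all (fun f => e f.1 f.2) (steps x s).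
Proof. by elim: s x => //= y s IH x; rewrite IH. Qed.

Lemma steps_map T T' (f : T -> T') x s :
  steps (f x) (map f s) = [seq (f e.1, f e.2) | e <- steps x s].
Proof. by elim: s x => //= y s IH x; rewrite IH. Qed.

Lemma open_side_uncrossed (c d : cell) (x : G) s :
  path adjG x s -> ~~ share_edge G c d ->
  count (on_side c d) (steps (pos x) (map (@pos G) s)) = 0%N.
Proof.
rewrite path_steps => /allP xs ncd; apply/eqP; rewrite -leqn0 leqNgt -has_count steps_map has_map.
apply: contra ncd => /hasP[e /xs ae /= /and4P[e1c e2c e1d e2d]].
by apply/existsP; exists e.1; apply/existsP; exists e.2; rewrite /edge_of /vertex_of ae e1c e2c e1d e2d.
Qed.

(** The parity is constant on each face, so the face of an encircled cell is
    bounded. *)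
Lemma encircled_square (x : G) s c :
  (forall c, interior_face G c -> square G c) ->
  path adjG x s -> last x s = x -> encircled x s c -> square G c.
Proof.
move=> faces xs closed xc; apply: faces.
have closedp : last (pos x) (map (@pos G) s) = pos x by rewrite last_map closed.
exists (\sum_(y : G) (`|(pos y).1| + `|(pos y).2|)) => d [t ct <-].
apply: (@winding_bounded _ (pos x) (map (@pos G) s) _ closedp) => [y|].
  rewrite -map_cons => /mapP[z _ ->]; rewrite (bigD1 z) //=.
  have : 0 <= \sum_(i | i != z) (`|(pos i).1| + `|(pos i).2|).
    by apply: sumr_ge0 => i _; rewrite addr_ge0.
  by move: (\sum_(i | _) _) => K; case: (pos z) => z1 z2 /=; lia.
rewrite -/(encircled x s _).
elim: t c xc ct {d} => //= d t IH c xc /andP[/andP[cd ncd] dt]; apply: IH dt.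
move: (winding_side cd (pos_path xs) closedp).
rewrite open_side_uncrossed // -[winding c _ _]/(encircled x s c) xc; rewrite /encircled. by case: (winding d _ _).
Qed.
End Graph.

(** * Every edge lies on a square *)

Lemma lattice_adj_neq (p q : point) : lattice_adj p q -> p != q.
Proof. by move=> h; apply/eqP => e; move: h; rewrite e /lattice_adj !subrr. Qed.

Lemma edge_sides (x y : point) : lattice_adj x y ->
  exists c, exists d, lattice_adj c d /\ on_side c d (x, y).
Proof.
case: x => x1 x2 /lattice_adjP D.
case: D => -> /=.
- exists (x1, x2), (x1, x2 - 1); rewrite /on_side !cornersE /lattice_adj /=; lia.
- exists (x1 - 1, x2), (x1 - 1, x2 - 1); rewrite /on_side !cornersE /lattice_adj /=; lia.
- exists (x1, x2), (x1 - 1, x2); rewrite /on_side !cornersE /lattice_adj /=; lia.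
- exists (x1, x2 - 1), (x1 - 1, x2 - 1); rewrite /on_side !cornersE /lattice_adj /=; lia.
Qed.

Lemma side_ends (c d : cell) (x y a : point) : lattice_adj c d ->
  on_side c d (x, y) -> x != y -> a \in corners c -> a \in corners d ->
  (a == x) || (a == y).
Proof.
case: c x y a => [c1 c2] [x1 x2] [y1 y2] [a1 a2] /lattice_adjP D.
rewrite /on_side !cornersE !xpair_eqE /=.
by case: D => -> /=; lia.
Qed.

(** A unit segment is a side of only two cells. *)
Lemma three_cells (c d e : cell) (x y : point) : lattice_adj x y ->
  on_side c d (x, y) -> x \in corners e -> y \in corners e -> c != d ->
  (e == c) || (e == d).
Proof.
case: c d e x => [c1 c2] [d1 d2] [e1 e2] [x1 x2] /lattice_adjP D.
rewrite /on_side !cornersE !xpair_eqE /=.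
by case: D => -> /=; lia.
Qed.

Lemma side_cells (c d : cell) (x y : point) : lattice_adj x y ->
  on_side c d (x, y) -> c != d -> lattice_adj c d.
Proof.
case: c d x => [c1 c2] [d1 d2] [x1 x2] /lattice_adjP D.
rewrite /on_side !cornersE /lattice_adj !xpair_eqE /=.
by case: D => -> /=; lia.
Qed.

Lemma two_free_sides (c a d : cell) : exists D1 D2 : cell,
  [/\ D1 != D2, lattice_adj c D1 /\ lattice_adj c D2,
      D1 != a /\ D2 != a & D1 != d /\ D2 != d].
Proof.
pose N := [:: (c.1 + 1, c.2); (c.1 - 1, c.2); (c.1, c.2 + 1); (c.1, c.2 - 1)].
pose s := [seq x <- N | (x != a) && (x != d)].
have adjN x : x \in s -> [/\ lattice_adj c x, x != a & x != d].
  rewrite mem_filter => /andP[/andP[xa xd]] xN; split => //.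
  by move: xN {xa xd}; rewrite !inE /lattice_adj => /or4P[] /eqP-> /=; lia.
have Nu : uniq N by rewrite /= !inE !xpair_eqE; lia.
have us : uniq s by rewrite filter_uniq.
have : (2 <= size s)%N.
  have := count_predC (fun x : point => (x != a) && (x != d)) N; rewrite -size_filter -/s [size N]/=.
  have : (count (predC (fun x : point => (x != a) && (x != d))) N <= 2)%N.
    rewrite -size_filter; apply: (@uniq_leq_size _ _ [:: a; d]); first by rewrite filter_uniq.
    by move=> x; rewrite mem_filter /= negb_and !negbK !inE => /andP[].
  by move=> h1 h2; rewrite -(leq_add2r 2) -[X in (X <= _)%N]h2 leq_add2l.
move: us adjN; case: s => [|x [|y s]] //= /andP[] xy _ adjN _.
have [] := adjN x _; first by rewrite !inE eqxx.
have [] := adjN y _; first by rewrite !inE eqxx orbT.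
move=> ? ? ? ? ? ?; exists x, y; split => //.
by move: xy; rewrite inE => /norP[].
Qed.

Section Faces.
Variable G : lattice_graph.
Hypothesis faces : forall c, interior_face G c -> square G c.

Definition walk_crosses (c d : cell) (x : G) s :=
  count (on_side c d) (steps (pos x) (map (@pos G) s)).

Lemma encircled_side (x : G) s c d : path (@adj G) x s -> last x s = x ->
  lattice_adj c d -> odd (walk_crosses c d x s) = encircled x s c (+) encircled x s d.
Proof.
move=> xs closed cd; apply: winding_side => //; first exact: pos_path.
by rewrite last_map closed.
Qed.

Lemma walk_crosses0 (x : G) s c d (e : rel G) : path e x s ->
  (forall a b, e a b -> ~~ on_side c d (pos a, pos b)) -> walk_crosses c d x s = 0%N.
Proof.
rewrite path_steps => /allP xs no; apply/eqP.
rewrite /walk_crosses -leqn0 leqNgt -has_count steps_map has_map.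
by apply/hasPn => f /xs /no.
Qed.

Lemma steps_cat T (x : T) s t : steps x (s ++ t) = steps x s ++ steps (last x s) t.
Proof. by elim: s x => //= y s IH x; rewrite IH. Qed.

Lemma walk_crosses_cat c d (x : G) s t :
  walk_crosses c d x (s ++ t) = (walk_crosses c d x s + walk_crosses c d (last x s) t)%N.
Proof. by rewrite /walk_crosses map_cat steps_cat count_cat last_map. Qed.

Lemma walk_crosses1 c d (x y : G) :
  walk_crosses c d x [:: y] = on_side c d (pos x, pos y).
Proof. by rewrite /walk_crosses /= addn0. Qed.

(** The walk from [x] to a third vertex that avoids [y], followed by one from there
    to [y] that avoids [x], is closed by the edge itself.  It uses the edge once,
    so exactly one of the two cells beside the edge is encircled. *)
Lemma edge_in_square (x y : G) : two_connected G -> adj x y ->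
  exists2 c, square G c & edge_of c x y.
Proof.
move=> [card3 _ conn] xy.
have [z zx zy] : exists2 z : G, z != x & z != y.
  have : (0 < #|~: [set x; y]|)%N.
    by rewrite cardsCs setCK subn_gt0 (leq_ltn_trans _ card3) // cards2; case: eqP.
  by case/card_gt0P => z; rewrite !inE => /norP[]; exists z.
have xNy : x != y by apply: contraTneq xy => ->; rewrite adj_irr.
have /connectP[s xs zs] := conn y x z xNy zy.
have yNx : y != x by rewrite eq_sym.
have /connectP[t zt yt] := conn x z y zx yNx.
have [c [d [cd xycd]]] := edge_sides (pos_adj xy).
have noside (v : G) : vertex_of c v -> vertex_of d v -> forall a b,
    [&& adj a b, a != v & b != v] -> ~~ on_side c d (pos a, pos b).
  move=> vc vd a b /and3P[ab av bv]; apply/negP => abcd.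
  have := side_ends cd abcd (lattice_adj_neq (pos_adj ab)) vc vd.
  by case/orP=> /eqP/(@pos_inj G) e; [rewrite e eqxx in av | rewrite e eqxx in bv].
have [/= xc yc xd yd] := and4P xycd.
have adjs v (a : G) p : path [rel a b | [&& adj a b, a != v & b != v]] a p -> path (@adj G) a p.
  by apply: sub_path => u w /= /andP[].
have walk : path (@adj G) x (s ++ t ++ [:: x]).
  by rewrite !cat_path (adjs y) //= -zs (adjs x) //= -yt adj_sym xy.
have closed : last x (s ++ t ++ [:: x]) = x by rewrite !last_cat.
have := encircled_side walk closed cd.
rewrite !walk_crosses_cat -zs -yt walk_crosses1.
rewrite (walk_crosses0 xs); last exact: noside.
rewrite (walk_crosses0 zt); last exact: noside.
have yxcd : on_side c d (pos y, pos x) by rewrite /on_side /= yc xc yd xd.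
rewrite yxcd => h.
have : encircled x (s ++ t ++ [:: x]) c || encircled x (s ++ t ++ [:: x]) d.
  by move: h; case: (encircled _ _ c) => //=.
case/orP => /(encircled_square faces walk closed) sq.
  by exists c; rewrite // /edge_of /vertex_of xy xc yc.
by exists d; rewrite // /edge_of /vertex_of xy xd yd.
Qed.

End Faces.

(** * Squares and chains *)

Lemma corner_detour (c x y : point) : x \in corners c -> y \in corners c ->
  x != y -> ~~ lattice_adj x y ->
  exists p, [/\ p \in corners c, lattice_adj x p & lattice_adj p y].
Proof.
case: c => c1 c2; rewrite !inE => /or4P[] /eqP-> /or4P[] /eqP->;
  rewrite xpair_eqE /lattice_adj /= => xy nxy; try by exfalso; lia.
all: first [exists (c1 + 1, c2); split; rewrite ?cornersE /=; lia
          | exists (c1, c2); split; rewrite ?cornersE /=; lia].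
Qed.

Section Squares.
Variable G : lattice_graph.

Lemma drawn_sym : symmetric (drawn G).
Proof.
by move=> p q; apply/existsP/existsP => -[x /existsP[y /and3P[xy xp yq]]];
  exists y; apply/existsP; exists x; rewrite adj_sym xy xp yq.
Qed.

Lemma square_side (c : cell) (p q : point) : square G c ->
  p \in corners c -> q \in corners c -> lattice_adj p q -> drawn G p q.
Proof.
rewrite /square /= => /and5P[d01 d12 d23 d30 _].
rewrite !inE => /or4P[] /eqP-> /or4P[] /eqP->; rewrite /lattice_adj /= => h;
  first [by [] | by rewrite drawn_sym | by exfalso; lia].
Qed.

Lemma square_corner (c : cell) (p : point) : square G c -> p \in corners c ->
  exists x : G, pos x = p.
Proof.
move=> sq pc.
have [q qc pq] : exists2 q, q \in corners c & lattice_adj p q.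
  move: pc; rewrite !inE => /or4P[] /eqP->; [exists (c.1 + 1, c.2)|exists c|
    exists (c.1, c.2 + 1)|exists c]; rewrite ?inE ?eqxx ?orbT // /lattice_adj /=; lia.
have /existsP[x /existsP[y /and3P[_ /eqP xp _]]] := square_side sq pc qc pq.
by exists x.
Qed.

Lemma square_adj (c : cell) (x y : G) : square G c ->
  vertex_of c x -> vertex_of c y -> lattice_adj (pos x) (pos y) -> adj x y.
Proof.
move=> sq xc yc /(square_side sq xc yc)/existsP[u /existsP[v]].
by case/and3P=> uv /eqP/(@pos_inj G) <- /eqP/(@pos_inj G) <-.
Qed.

Lemma share_edge_lattice_adj (c d : cell) :
  c != d -> share_edge G c d -> lattice_adj c d.
Proof.
move=> cd /existsP[x /existsP[y /andP[/and3P[xy xc yc] /and3P[_ xd yd]]]].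
by apply: side_cells (pos_adj xy) _ cd; rewrite /on_side /= -!/(vertex_of _ _) xc yc xd yd.
Qed.

Lemma lattice_adj_side (c d : cell) : lattice_adj c d ->
  exists p, exists q, lattice_adj p q /\ on_side c d (p, q).
Proof.
case: c => c1 c2 /lattice_adjP D.
case: D => -> /=.
- exists (c1 + 1, c2), (c1 + 1, c2 + 1); rewrite /on_side !cornersE /lattice_adj /=; lia.
- exists (c1, c2), (c1, c2 + 1); rewrite /on_side !cornersE /lattice_adj /=; lia.
- exists (c1, c2 + 1), (c1 + 1, c2 + 1); rewrite /on_side !cornersE /lattice_adj /=; lia.
- exists (c1, c2), (c1 + 1, c2); rewrite /on_side !cornersE /lattice_adj /=; lia.
Qed.

Lemma square_share_edge (c d : cell) :
  square G c -> lattice_adj c d -> share_edge G c d.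
Proof.
move=> sq /lattice_adj_side[p [q [pq /and4P[/= pc qc pd qd]]]].
have /existsP[x /existsP[y /and3P[xy /eqP xp /eqP yq]]] := square_side sq pc qc pq.
apply/existsP; exists x; apply/existsP; exists y.
by rewrite /edge_of /vertex_of xy xp yq pc qc pd qd.
Qed.

End Squares.

Section Chain.
Variables (G : lattice_graph) (n : nat) (C : seq cell).
Hypothesis chain : polyomino_chain G n C.

Lemma chain_size : size C = n.
Proof. by case: chain. Qed.

Lemma chain_square i : (i < n)%N -> square G C`_i.
Proof. by case: chain => _ sz _ sq _ ilt; rewrite -sq mem_nth ?sz. Qed.

Lemma square_chain c : square G c -> exists2 i, (i < n)%N & c = C`_i.
Proof.
case: chain => _ sz _ sq _; rewrite -sq => /(nthP 0)[i ilt <-].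
by exists i; rewrite -?sz.
Qed.

Lemma chain_eq i j : (i < n)%N -> (j < n)%N -> (C`_i == C`_j) = (i == j).
Proof. by case: chain => _ sz un _ _ ilt jlt; rewrite nth_uniq ?sz. Qed.

Lemma chain_adj i j : (i < n)%N -> (j < n)%N ->
  lattice_adj C`_i C`_j = (j == i.+1) || (i == j.+1).
Proof.
move=> ilt jlt; case: (chain) => _ _ _ _ <- //; rewrite /adjacent.
apply/idP/andP => [ij | [ij]]; last exact: share_edge_lattice_adj.
by rewrite lattice_adj_neq // (square_share_edge (chain_square ilt)).
Qed.

Lemma chain_share i j (x y : G) : (i < n)%N -> (j < n)%N ->
  edge_of C`_i x y -> edge_of C`_j x y -> [|| i == j, j == i.+1 | i == j.+1].
Proof.
move=> ilt jlt xyi xyj; rewrite -chain_adj // -chain_eq //.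
case: eqP => //= /eqP ij; apply: share_edge_lattice_adj (G) _ _ ij _.
by apply/existsP; exists x; apply/existsP; exists y; rewrite xyi.
Qed.

Lemma chain_share_next i j (x y : G) : (i < j < n)%N ->
  edge_of C`_i x y -> edge_of C`_j x y -> j = i.+1.
Proof.
case/andP=> ij jn xyi xyj.
by case/or3P: (chain_share (ltn_trans ij jn) jn xyi xyj) => /eqP e; lia.
Qed.

Let faces c : interior_face G c -> square G c.
Proof. by case: chain => -[_ h] _ _ _ _; apply: h. Qed.

Lemma chain_edge (x y : G) : adj x y -> exists2 i, (i < n)%N & edge_of C`_i x y.
Proof.
case: chain => -[conn _] _ _ _ _ xy.
have [c /square_chain[i ilt ->] e] := edge_in_square faces conn xy.
by exists i.
Qed.

(** Connectedness puts every vertex on an edge. *)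
Lemma chain_vertex (x : G) : exists2 i, (i < n)%N & vertex_of C`_i x.
Proof.
case: chain => -[[card3 conn _] _] _ _ _ _.
have [z zx] : exists z : G, z != x.
  have : (0 < #|~: [set x]|)%N by rewrite cardsCs setCK cards1 subn_gt0 ltnW.
  by case/card_gt0P => z; rewrite !inE; exists z.
have /connectP[[|y s] /= xs zs] := conn x z; first by rewrite zs eqxx in zx.
have /andP[xy _] := xs; have [i ilt /and3P[_ xi _]] := chain_edge xy.
by exists i.
Qed.

Definition before j : rel G := [rel a b | [exists i : 'I_j, edge_of C`_i a b]].

Lemma before_sym j : symmetric (before j).
Proof.
move=> a b; apply/existsP/existsP => -[i /and3P[ab ai bi]]; exists i;
by rewrite /edge_of adj_sym ab bi ai.
Qed.

Lemma before_square j i (x y : G) : (i < j <= n)%N ->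
  vertex_of C`_i x -> vertex_of C`_i y -> connect (before j) x y.
Proof.
case/andP=> ij jn xi yi; have sq := chain_square (leq_trans ij jn).
have nb (a b : G) : vertex_of C`_i a -> vertex_of C`_i b ->
    lattice_adj (pos a) (pos b) -> connect (before j) a b.
  move=> ai bi ab; apply: connect1; apply/existsP; exists (Ordinal ij).
  by rewrite /edge_of ai bi (square_adj sq ai bi ab).
have [->|xy] := eqVneq x y; first exact: connect0.
case xya: (lattice_adj (pos x) (pos y)); first exact: nb.
have [p [pi xp py]] : exists p : point,
    [/\ p \in corners C`_i, lattice_adj (pos x) p & lattice_adj p (pos y)].
  apply: (corner_detour xi yi); last by rewrite xya.
  by rewrite (inj_eq (@pos_inj G)).
have [z zp] := square_corner sq pi; rewrite -zp in pi xp py.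
exact: connect_trans (nb _ _ xi pi xp) (nb _ _ pi yi py).
Qed.

Lemma before_connect j i i' (x y : G) : (i < j <= n)%N -> (i' < j)%N ->
  vertex_of C`_i x -> vertex_of C`_i' y -> connect (before j) x y.
Proof.
wlog: i i' x y / (i <= i')%N => [W|].
  move=> /andP[ij jn] i'j xi yi'; case: (leqP i i') => h; first by apply: (W i i'); rewrite ?ij.
  by rewrite (sym_connect_sym (@before_sym j)); apply: (W i' i); rewrite ?i'j // ltnW.
move=> le_ii' /andP[ij jn] i'j xi.
elim: i' le_ii' i'j y => [|m IH] le_im mj y ym.
  by move: le_im xi; rewrite leqn0 => /eqP-> xi; apply: before_square xi ym; rewrite mj.
move: le_im; rewrite leq_eqVlt => /predU1P[im|le_im].
  by rewrite im in xi; apply: before_square xi ym; rewrite mj.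
have mn : (m.+1 < n)%N by exact: leq_trans mj jn.
have : lattice_adj C`_m C`_m.+1 by rewrite chain_adj ?eqxx // ltnW.
move/(square_share_edge (chain_square (ltnW mn))).
case/existsP=> z /existsP[_ /andP[/and3P[_ zm _] /and3P[_ zm' _]]].
by apply: connect_trans (IH _ _ _ zm) (before_square _ zm' ym); rewrite ?mj // ltnW.
Qed.

(** An encircled square passes the odd parity on to both [D1] and [D2], which are
    then squares of the chain; but besides [C`_i.-1] only [C`_i.+1] is adjacent
    to [C`_i]. *)
Lemma not_encircled i (x : G) s (D1 D2 : cell) : (i < n)%N ->
  path (@adj G) x s -> last x s = x -> D1 != D2 ->
  lattice_adj C`_i D1 -> lattice_adj C`_i D2 ->
  (0 < i)%N -> D1 != C`_i.-1 -> D2 != C`_i.-1 ->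
  walk_crosses C`_i D1 x s = 0%N -> walk_crosses C`_i D2 x s = 0%N ->
  encircled x s C`_i = false.
Proof.
move=> ilt xs closed D12 a1 a2 i0 n1 n2 z1 z2; apply/negP => xc.
have next D : lattice_adj C`_i D -> D != C`_i.-1 -> walk_crosses C`_i D x s = 0%N ->
    (i.+1 < n)%N /\ D = C`_i.+1.
  move=> a nD z; have := encircled_side xs closed a; rewrite z xc /= => xD.
  have /(encircled_square faces xs closed)/square_chain[m mn Dm] : encircled x s D.
    by case: (encircled _ _ D) xD.
  move: a nD; rewrite Dm chain_adj // chain_eq //; last by lia.
  by case/orP=> /eqP mi; rewrite mi in mn *; rewrite ?eqxx //=; lia.
have [_ e1] := next _ a1 n1 z1; have [_ e2] := next _ a2 n2 z2.
by rewrite e1 e2 eqxx in D12.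
Qed.

(** If [x] were a corner of an earlier square, a walk along the earlier squares
    would lead to [x] from a corner that [C`_j] shares with its predecessor, and
    the side of [C`_j] between these two corners would close it.  The parity then
    differs across that side.  But [C`_j] is not encircled, since the walk avoids
    two further sides of it; and the cell beyond the closing side could only be
    [C`_j.+1], which is not encircled for the same reason. *)
Lemma far_corner_new i j (x : G) : (i < j < n)%N -> vertex_of C`_j x ->
  ~~ vertex_of C`_j.-1 x -> ~~ vertex_of C`_i x.
Proof.
move=> /andP[ij jn] xj xj'; apply/negP => xi.
have j0 : (0 < j)%N by lia.
have j'j : lattice_adj C`_j.-1 C`_j by rewrite chain_adj ?prednK ?eqxx //; lia.
have [p [pj pj' xp]] : exists p : point,
    [/\ p \in corners C`_j, p \in corners C`_j.-1 & lattice_adj (pos x) p].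
  move: xj xj' j'j; rewrite lattice_adj_sym /vertex_of !cornersE.
  case: (pos x) C`_j C`_j.-1 => [x1 x2] [c1 c2] d + + /lattice_adjP D /=.
  case: D => -> /= *.
  - by exists (x1 + 1, x2); rewrite !cornersE /lattice_adj /=; split; lia.
  - by exists (x1 - 1, x2); rewrite !cornersE /lattice_adj /=; split; lia.
  - by exists (x1, x2 + 1); rewrite !cornersE /lattice_adj /=; split; lia.
  - by exists (x1, x2 - 1); rewrite !cornersE /lattice_adj /=; split; lia.
have [y yp] := square_corner (chain_square jn) pj; subst p.
have xy : adj x y by apply: square_adj (chain_square jn) _ _ xp.
have j'lt : (j.-1 < j)%N by rewrite prednK.
have : connect (before j) y x.
  by apply: (@before_connect j j.-1 i); rewrite ?j'lt // ltnW.
case/connectP => s ys xs.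
have sadj : path (@adj G) y s.
  by apply: sub_path ys => a b /existsP[m /and3P[]].
have walk : path (@adj G) y (s ++ [:: y]) by rewrite cat_path sadj /= -xs xy.
have closed : last y (s ++ [:: y]) = y by rewrite last_cat.
have [c [d [cd xycd]]] := edge_sides (pos_adj xy).
have [o jo xyo] : exists2 o, lattice_adj C`_j o & on_side C`_j o (pos x, pos y).
  have [xc yc xd yd] := and4P xycd; have cNd := lattice_adj_neq cd.
  have := three_cells (pos_adj xy) xycd xj pj cNd.
  case/orP=> /eqP e; rewrite e; first by exists d.
  by exists c; rewrite 1?lattice_adj_sym // /on_side /= xc yc xd yd.
have oNj' : o != C`_j.-1.
  by apply: contraNneq xj' => <-; case/and4P: xyo.
(* An earlier square meets [C`_j] in a side only if it is [C`_j.-1], and then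
   that side is not one towards [D]. *)
have quiet_steps D : lattice_adj C`_j D -> D != C`_j.-1 ->
    walk_crosses C`_j D y s = 0%N.
  move=> jD Dj'; apply: walk_crosses0 ys _ => a b /existsP[m abm]; apply/negP => abD.
  have [aj bj aD bD] := and4P abD; have [ab am bm] := and3P abm.
  have abj : edge_of C`_j a b by rewrite /edge_of /vertex_of ab aj bj.
  have mj' : j = m.+1 by apply: chain_share_next abm abj; rewrite ltn_ord.
  have mj : m = j.-1 :> nat by rewrite [in RHS]mj'.
  rewrite mj in am bm.
  have := three_cells (pos_adj ab) abD am bm (lattice_adj_neq jD).
  by rewrite (negPf (lattice_adj_neq j'j)) eq_sym (negPf Dj').
have quiet_j D : lattice_adj C`_j D -> D != C`_j.-1 -> D != o ->
    walk_crosses C`_j D y (s ++ [:: y]) = 0%N.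
  move=> jD Dj' Do; rewrite walk_crosses_cat -xs walk_crosses1 quiet_steps //.
  apply/eqP; rewrite eqb0; apply/negP => xyD; have := three_cells (pos_adj xy) xyo.
  have [_ _ xD yD] := and4P xyD => /(_ D xD yD (lattice_adj_neq jo)).
  by rewrite (negPf Do) orbF eq_sym (negPf (lattice_adj_neq jD)).
have quiet_next D : (j.+1 < n)%N -> lattice_adj C`_j.+1 D -> D != C`_j ->
    walk_crosses C`_j.+1 D y (s ++ [:: y]) = 0%N.
  move=> j1n jD Dj; rewrite walk_crosses_cat -xs walk_crosses1.
  have -> : on_side C`_j.+1 D (pos x, pos y) = false.
    apply/negP=> xyD; have := three_cells (pos_adj xy) xyD xj pj (lattice_adj_neq jD).
    by rewrite chain_eq ?(ltnW j1n) // [_ == D]eq_sym (negPf Dj) orbF ltn_eqF.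
  rewrite addn0; apply: walk_crosses0 ys _ => a b /existsP[m abm]; apply/negP => abD.
  have [aj bj aD bD] := and4P abD; have [ab am bm] := and3P abm.
  have abj : edge_of C`_j.+1 a b by rewrite /edge_of /vertex_of ab aj bj.
  have mj : j.+1 = m.+1 by apply: chain_share_next abm abj; rewrite ltnW ?ltnS.
  by have := ltn_ord m; rewrite -ltnS -mj ltnn.
have not_j : encircled y (s ++ [:: y]) C`_j = false.
  have [D1 [D2 [D12 [a1 a2] [n1 n2] [o1 o2]]]] := two_free_sides C`_j C`_j.-1 o.
  by apply: (not_encircled (D1 := D1) (D2 := D2)) => //; apply: quiet_j.
have odd_o : odd (walk_crosses C`_j o y (s ++ [:: y])).
  by rewrite walk_crosses_cat -xs walk_crosses1 quiet_steps // xyo.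
have : encircled y (s ++ [:: y]) o.
  by have := encircled_side walk closed jo; rewrite odd_o not_j /=; case: (encircled _ _ o).
move=> co; have := encircled_square faces walk closed co.
case/square_chain=> m mn om; rewrite om in co oNj' jo.
move: jo oNj'; rewrite chain_adj // chain_eq ?(leq_ltn_trans (leq_pred j) jn) //.
case/orP=> /eqP jm; last by rewrite jm /= eqxx.
move=> _; rewrite jm in mn co.
have [D1 [D2 [D12 [a1 a2] [n1 n2] _]]] := two_free_sides C`_j.+1 C`_j C`_j.
suff : encircled y (s ++ [:: y]) C`_j.+1 = false by rewrite co.
by apply: (not_encircled (D1 := D1) (D2 := D2)) => //; apply: quiet_next.
Qed.

End Chain.

(** * Consecutive cells *)

(** Reflection in the centre of [c]. *)
Definition opposite (c : cell) (p : point) : point :=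
  (c.1 + c.1 + 1 - p.1, c.2 + c.2 + 1 - p.2).

(** For two cells that are two steps apart: the path between them is not
    straight. *)
Definition turns (a b : cell) : bool := (a.1 != b.1) && (a.2 != b.2).

Lemma opposite_corner (c : cell) (p : point) :
  p \in corners c -> opposite c p \in corners c.
Proof. case: c p => [c1 c2] [p1 p2]; rewrite !cornersE /=; lia. Qed.

Lemma opposite_not_adj (c : cell) (p : point) :
  p \in corners c -> lattice_adj p (opposite c p) = false.
Proof.
case: c p => [c1 c2] [p1 p2]; rewrite !inE => /or4P[] /eqP[-> ->];
rewrite /lattice_adj /=; lia.
Qed.

Lemma opposite_side (c : cell) (p q : point) :
  lattice_adj p q -> lattice_adj (opposite c p) (opposite c q).
Proof.
case: p => p1 p2 /lattice_adjP D; rewrite /lattice_adj.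
by case: D => -> /=; lia.
Qed.

Lemma adj_opposite (c : cell) (p q : point) :
  p \in corners c -> q \in corners c -> lattice_adj p q ->
  lattice_adj p (opposite c q).
Proof.
case: c p => [c1 c2] [p1 p2] + + /lattice_adjP D; rewrite !cornersE /lattice_adj.
by case: D => -> /=; lia.
Qed.

Lemma corners_opposite (c : cell) (p q x : point) :
  p \in corners c -> q \in corners c -> lattice_adj p q ->
  (x \in corners c) = (x \in [:: p; q; opposite c q; opposite c p]).
Proof.
case: c p x => [c1 c2] [p1 p2] [x1 x2] + + /lattice_adjP D.
rewrite !cornersE !inE.
by case: D => -> /=; rewrite !xpair_eqE /=; lia.
Qed.

Lemma opposite_uniq (c : cell) (p q : point) : p \in corners c -> q \in corners c ->
  lattice_adj p q -> uniq [:: p; q; opposite c q; opposite c p].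
Proof.
case: c p => [c1 c2] [p1 p2] + + /lattice_adjP D.
rewrite !cornersE /= !inE.
by case: D => -> /=; rewrite !xpair_eqE /=; lia.
Qed.

Lemma opposite_far (b c : cell) (p q : point) :
  lattice_adj b c -> on_side b c (p, q) -> lattice_adj p q ->
  (opposite c p \notin corners b) /\ (opposite c q \notin corners b).
Proof.
case: b p => [b1 b2] [p1 p2] /lattice_adjP D + /lattice_adjP E; rewrite /on_side !cornersE.
by case: D => -> /=; case: E => -> /=; lia.
Qed.

Lemma far_opposite (c d : cell) (p q : point) :
  lattice_adj c d -> p \in corners c -> q \in corners c ->
  lattice_adj p q -> p \notin corners d -> q \notin corners d ->
  (opposite c p \in corners d) && (opposite c q \in corners d).
Proof.
case: c p => [c1 c2] [p1 p2] /lattice_adjP D + + /lattice_adjP E; rewrite !cornersE.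
by case: D => -> /=; case: E => -> /=; lia.
Qed.

Lemma pivot_opposite (c d : cell) (p q : point) :
  lattice_adj c d -> p \in corners c -> q \in corners c ->
  lattice_adj p q -> p \in corners d -> q \notin corners d -> opposite c q \in corners d.
Proof.
case: c p => [c1 c2] [p1 p2] /lattice_adjP D + + /lattice_adjP E; rewrite !cornersE.
by case: D => -> /=; case: E => -> /=; lia.
Qed.

Lemma straight_far (b c d : cell) (x : point) :
  lattice_adj b c -> lattice_adj c d -> b != d ->
  ~~ turns b d -> x \in corners b -> x \in corners c -> x \notin corners d.
Proof.
case: b x => [b1 b2] [x1 x2] /lattice_adjP D + + + + +; rewrite !cornersE /turns.
case: D => -> /= /lattice_adjP[] -> /=; rewrite !xpair_eqE /=; lia.
Qed.

(** At a turn the entering and the leaving side have exactly one common corner,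
    the pivot. *)
Lemma turn_pivot (b c d : cell) (x y : point) :
  lattice_adj b c -> lattice_adj c d -> turns b d ->
  on_side b c (x, y) -> lattice_adj x y -> (y \in corners d) = (x \notin corners d).
Proof.
case: b x => [b1 b2] [x1 x2] /lattice_adjP D + + + /lattice_adjP E; rewrite /on_side !cornersE /turns.
case: D => -> /= /lattice_adjP[] -> /=; try lia; case: E => -> /=; lia.
Qed.

(** The four cells around [x] form a cycle of adjacent cells, so a path through
    all of them ends next to where it began. *)
Lemma no_block (a b c d : cell) (x : point) :
  lattice_adj a b -> lattice_adj b c -> lattice_adj c d ->
  a != c -> b != d -> x \in corners a -> x \in corners b -> x \in corners c ->
  x \in corners d -> lattice_adj a d.
Proof.
case: a => a1 a2 /lattice_adjP D bc cd ac bd xa xb xc xd.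
have [] : [\/ x = (a1, a2), x = (a1 + 1, a2), x = (a1 + 1, a2 + 1) | x = (a1, a2 + 1)].
  by move: xa; rewrite !inE => /or4P[] /eqP;
    [constructor 1|constructor 2|constructor 3|constructor 4].
all: move=> e; move: bc cd ac bd xb xc xd; rewrite {x xa}e !cornersE;
  case: D => -> /= /lattice_adjP[] -> /= /lattice_adjP[] -> /=;
  rewrite !xpair_eqE /lattice_adj /=; lia.
Qed.

Lemma far_side (c d : cell) : lattice_adj c d -> exists p q : point,
  [/\ lattice_adj p q, p \in corners c /\ q \in corners c & p \notin corners d /\ q \notin corners d].
Proof.
case: c => c1 c2 /lattice_adjP D; case: D => -> /=.
- exists (c1, c2), (c1, c2 + 1); rewrite !cornersE /lattice_adj /=; split; lia.
- exists (c1 + 1, c2), (c1 + 1, c2 + 1); rewrite !cornersE /lattice_adj /=; split; lia.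
- exists (c1, c2), (c1 + 1, c2); rewrite !cornersE /lattice_adj /=; split; lia.
- exists (c1, c2 + 1), (c1 + 1, c2 + 1); rewrite !cornersE /lattice_adj /=; split; lia.
Qed.

(** * Edge indices and ladders *)

Section Edges.
Variable G : sgraph.

Lemma set2_inj (T : finType) (x y z t : T) : [set x; y] = [set z; t] ->
  (x = z /\ y = t) \/ (x = t /\ y = z).
Proof.
move=> E.
have /set2P[xz|xt] : x \in [set z; t] by rewrite -E set21.
  subst z; have /set2P[tx|ty] : t \in [set x; y] by rewrite E set22.
    by subst t; have : y \in [set x; x]; [rewrite -E set22 | rewrite setUid inE => /eqP ->; left].
  by left.
subst t; have /set2P[zx|zy] : z \in [set x; y] by rewrite E set21.
  by subst z; have : y \in [set x; x]; [rewrite -E set22 | rewrite setUid inE => /eqP ->; left].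
by right.
Qed.

Lemma edgesP e :
  reflect (exists x y : G, adj x y /\ e = [set x; y]) (e \in edges G).
Proof.
rewrite inE; apply: (iffP existsP) => [[x /existsP[y /andP[xy /eqP->]]]|[x [y [xy ->]]]].
  by exists x, y.
by exists x; apply/existsP; exists y; rewrite xy eqxx.
Qed.

(** [y |-> [set x; y]] maps the neighbours of [x] one-to-one onto the edges at [x]. *)
Lemma deg_edges (x : G) : deg x = (\sum_(e in edges G) (x \in e))%N.
Proof.
rewrite -big_mkcondr sum1_card /deg.
have inj : {in [set y | adj x y] &, injective (fun y => [set x; y])}.
  move=> y z; rewrite !inE => xy xz /set2_inj[[_ //]|[xz' yx]].
  by rewrite yx adj_irr in xy.
rewrite -(card_in_imset inj); apply: eq_card => e; rewrite [in RHS]unfold_in /=.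
apply/imsetP/andP => [[y + ->] | [/edgesP[y [z [yz ->]]]]].
  by rewrite inE => xy; split; [apply/edgesP; exists x, y | exact: set21].
case/set2P => ->; first by exists z; rewrite ?inE.
by exists y; rewrite ?inE 1?adj_sym // setUC.
Qed.

Lemma dsum_edge (x y : G) : x != y -> dsum [set x; y] = (deg x + deg y)%N.
Proof. by move=> xy; rewrite /dsum big_setU1 ?inE // big_set1. Qed.

Lemma dprod_edge (x y : G) : x != y -> dprod [set x; y] = (deg x * deg y)%N.
Proof. by move=> xy; rewrite /dprod big_setU1 ?inE // big_set1. Qed.

End Edges.

(** An index that sees an edge only through the sum and the product of the degrees
    of its ends, with values in an arbitrary monoid so that sums and products
    over the edges are treated alike. *)
Definition edge_index (T : Type) (op : T -> T -> T) (idx : T) (F : nat -> nat -> T)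
    (G : sgraph) : T :=
  \big[op/idx]_(e in edges G) F (dsum e) (dprod e).

Lemma edge_index_isomorphic (T : Type) (idx : T) (op : Monoid.com_law idx) F
  (G H : sgraph) : isomorphic G H -> edge_index op idx F G = edge_index op idx F H.
Proof.
case=> f fbij fadj; have finj := bij_inj fbij; have [g fg gf] := fbij.
have degf x : deg (f x) = deg x.
  rewrite /deg -(card_imset _ finj); apply: eq_card => y; rewrite inE.
  apply/idP/imsetP => [xy|[z + ->]]; last by rewrite inE fadj.
  by exists (g y); rewrite ?inE ?gf // -fadj gf.
have -> : edge_index op idx F H = \big[op/idx]_(e in [set f @: (e : {set G}) | e in edges G]) F (dsum e) (dprod e).
  apply: eq_bigl => e; apply/edgesP/imsetP => [[x [y [xy ->]]]|[e' /edgesP[x [y [xy ->]]] ->]].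
    exists [set g x; g y]; last by rewrite imsetU1 imset_set1 !gf.
    by apply/edgesP; exists (g x), (g y); rewrite -fadj !gf.
  by exists (f x), (f y); rewrite fadj imsetU1 imset_set1.
rewrite big_imset /=; last by move=> e e' _ _; apply: imset_inj.
apply: eq_bigr => e _; rewrite /dsum /dprod !big_imset /=; try by move=> x y _ _; apply: finj.
by congr F; apply: eq_bigr => x _; rewrite degf.
Qed.

(** Vertices of a ladder carry labels [(i, b)]: the pair with [i = j.+1] is born with
    square [j], the pair with [i = 0] consists of the ends of the first side.
    Square [j] is entered through the side from [(j, true)] to [second_end k j],
    and [(j, true)] is its pivot if it turns.  After a turn the chain leaves
    through the pivot, which is why it is still present in the next entering
    side; this is the first case of [second_end].  The corner that continues the
    pivot side is [(j.+1, true)], unless [f j] holds: then the two new corners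
    trade names, because the next pivot is on the side of [second_end k j]. *)
Definition label := (nat * bool)%type.

Definition second_end (k : nat -> bool) j : label :=
  if k j.-1 then (j.-1, true) else (j, false).
Definition rung j : label * label := ((j, true), (j, false)).
Definition pivot_rail (f : nat -> bool) j : label * label := ((j, true), (j.+1, ~~ f j)).
Definition second_rail k (f : nat -> bool) j : label * label := (second_end k j, (j.+1, f j)).
Definition square_labels k f j : seq label :=
  [:: (j, true); second_end k j; (j.+1, ~~ f j); (j.+1, f j)].
Definition ladder_edges n k f :=
  [seq rung j | j <- iota 0 n.+1] ++ [seq pivot_rail f j | j <- iota 0 n]
    ++ [seq second_rail k f j | j <- iota 0 n].

Record ladder (G : sgraph) n k f (v : label -> G) : Prop := Ladder {
  ladder_inj : forall a b, (a.1 <= n)%N -> (b.1 <= n)%N -> v a = v b -> a = b;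
  ladder_onto : forall x, exists2 a, (a.1 <= n)%N & v a = x;
  ladder_adj : forall a b, (a.1 <= n)%N -> (b.1 <= n)%N ->
    adj (v a) (v b) = ((a, b) \in ladder_edges n k f) || ((b, a) \in ladder_edges n k f);
  ladder_turn : forall j, k j -> (0 < j < n.-1)%N;
  ladder_flip : forall j, f j -> [/\ (0 < j)%N, ~~ k j & k j.+1] }.

Lemma mem_ladder_edges n k f e : reflect
  [\/ exists2 j, (j <= n)%N & e = rung j,
      exists2 j, (j < n)%N & e = pivot_rail f j |
      exists2 j, (j < n)%N & e = second_rail k f j] (e \in ladder_edges n k f).
Proof.
rewrite !mem_cat; apply: (iffP or3P) => -[].
- by case/mapP => j; rewrite mem_iota => ? ?; constructor 1; exists j.
- by case/mapP => j; rewrite mem_iota => ? ?; constructor 2; exists j.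
- by case/mapP => j; rewrite mem_iota => ? ?; constructor 3; exists j.
- by case=> j ? ->; constructor 1; rewrite map_f // mem_iota.
- by case=> j ? ->; constructor 2; rewrite map_f // mem_iota.
- by case=> j ? ->; constructor 3; rewrite map_f // mem_iota.
Qed.

(** An order of birth, in which the second component of a listed edge is always
    the younger end. *)
Definition rank (a : label) : nat := a.1.*2 + ~~ a.2.

Lemma ladder_edge_rank n k f e : e \in ladder_edges n k f ->
  [/\ (rank e.1 < rank e.2)%N, (e.1.1 <= n)%N & (e.2.1 <= n)%N].
Proof.
rewrite /rank; case/mem_ladder_edges => -[j jn ->]; split=> //=;
  rewrite /second_end ?doubleS; case: (k _); case: (f _) => //=; lia.
Qed.

Lemma ladder_edges_uniq n (k f : nat -> bool) :
  (forall j, k j -> 0 < j)%N -> uniq (ladder_edges n k f).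
Proof.
move=> k0; rewrite !cat_uniq !map_inj_uniq ?iota_uniq; try by move=> i j [].
rewrite andTb andbT has_cat negb_or -andbA; apply/and3P; split.
- apply/hasPn => e /mapP[j _ ->]; apply/negP => /mapP[i _] []; lia.
- apply/hasPn => e /mapP[j _ ->]; apply/negP => /mapP[i _] []; rewrite /second_end.
  by case: ifP => // /k0 ? []; lia.
- apply/hasPn => e /mapP[j _ ->]; apply/negP => /mapP[i _] []; rewrite /second_end.
  by case: ifP => // /k0 ? []; lia.
Qed.

Section Ladder.
Variables (G : sgraph) (n : nat) (k f : nat -> bool) (v : label -> G).
Hypothesis lad : ladder n k f v.
Local Notation E := (ladder_edges n k f).

Lemma ladder_eq a b : (a.1 <= n)%N -> (b.1 <= n)%N -> (v a == v b) = (a == b).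
Proof. by move=> an bn; apply/eqP/eqP => [/(ladder_inj lad an bn)|->]. Qed.

Lemma ladder_edge_neq e : e \in E -> v e.1 != v e.2.
Proof.
case/ladder_edge_rank => r an bn; rewrite ladder_eq //.
by apply/eqP => ee; rewrite ee ltnn in r.
Qed.

(** The rank orients the edges, so different entries of the list are different
    edges. *)
Lemma big_ladder_edges (T : Type) (idx : T) (op : Monoid.com_law idx) (w : {set G} -> T) :
  \big[op/idx]_(e in edges G) w e = \big[op/idx]_(e <- E) w [set v e.1; v e.2].
Proof.
rewrite -(big_map (fun e => [set v e.1; v e.2]) predT w) big_uniq; last first.
  rewrite map_inj_in_uniq; first by apply: ladder_edges_uniq => j /(ladder_turn lad)/andP[].
  move=> [a b] [c d] /ladder_edge_rank[/= ab an bn] /ladder_edge_rank[/= cd cn dn].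
  case/set2_inj => -[]; first by move=> /(ladder_inj lad an cn) -> /(ladder_inj lad bn dn) ->.
  by move=> /(ladder_inj lad an dn) ad /(ladder_inj lad bn cn) bc; move: ab; rewrite ad bc; lia.
apply: eq_bigl => e; apply/edgesP/mapP => [[x [y [xy ->]]]|[[a b] abE ->]].
  have [[a an ax] [b bn bY]] := (ladder_onto lad x, ladder_onto lad y); subst x y.
  rewrite (ladder_adj lad) // in xy; case/orP: xy => [abE|baE]; first by exists (a, b).
  by exists (b, a); rewrite // setUC.
have [_ an bn] := ladder_edge_rank abE.
by exists (v a), (v b); rewrite (ladder_adj lad) // abE.
Qed.

Lemma count_iota_pred1 (p : pred nat) (c : bool) m :
  (forall j, p j = c && (j == m)) -> count p (iota 0 n) = c && (m < n)%N :> nat.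
Proof.
move=> pE; rewrite (eq_count pE); case: c {pE} => /=; last by rewrite count_pred0.
by rewrite (count_uniq_mem _ (iota_uniq _ _)) mem_iota.
Qed.

(** Besides its rung, a vertex lies on the rail that reaches it, if it is not on
    the first side, and on one rail for each square that is entered through it. *)
Lemma ladder_deg i b : (i <= n)%N -> deg (v (i, b)) =
  (1 + (0 < i) + if b then (i < n) + k i else (i < n) && ~~ k i.-1)%N.
Proof.
move=> iln; rewrite deg_edges big_ladder_edges.
have k0 j : k j -> (0 < j)%N by move=> /(ladder_turn lad)/andP[].
rewrite (eq_big_seq (fun e => ((i, b) == e.1) || ((i, b) == e.2) : nat)); last first.
  move=> e /ladder_edge_rank[_ en1 en2]; rewrite !inE !ladder_eq //.
rewrite !big_cat !big_map.
have toCount m (p : pred nat) : (\sum_(j <- iota 0 m) p j)%N = count p (iota 0 m).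
  by rewrite -big_mkcond sum1_count.
have countU (p q : pred nat) : (forall j, ~~ (p j && q j)) ->
    count (fun j => p j || q j) (iota 0 n) = (count p (iota 0 n) + count q (iota 0 n))%N.
  move=> dis; rewrite -count_predUI [X in (_ + X)%N](@eq_count _ _ pred0) => [|j].
    by rewrite count_pred0 addn0.
  by rewrite /= (negPf (dis j)).
have rungs : count (fun j => ((i, b) == (rung j).1) || ((i, b) == (rung j).2))
    (iota 0 n.+1) = 1%N.
  rewrite (@eq_count _ _ (pred1 i)) => [|j].
    by rewrite (count_uniq_mem _ (iota_uniq _ _)) mem_iota add0n ltnS iln.
  by rewrite /= !xpair_eqE eq_sym; case: (b); rewrite ?andbF ?orbF ?andbT.
have into (g : pred nat) : count (fun j => (i, b) == (j.+1, g j)) (iota 0 n)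
    = ((0 < i)%N && (b == g i.-1)) :> nat.
  rewrite (@count_iota_pred1 _ ((0 < i)%N && (b == g i.-1)) i.-1) => [|j].
    by congr nat_of_bool; rewrite andbAC; case: (i) iln => //= m ->.
  rewrite xpair_eqE; case: (i) => //= m; rewrite eqSS [m == j]eq_sym.
  by case: (j =P m) => [->|]; rewrite ?andbF ?andbT.
have starts : count (fun j => (i, b) == second_end k j) (iota 0 n) =
    if b then k i : nat else ((i < n) && ~~ k i.-1)%N.
  case: (b).
    rewrite (@count_iota_pred1 _ (k i) i.+1) => [|j].
      by case: (boolP (k i)) => //= /(ladder_turn lad); case: ltnP => //; lia.
    rewrite /second_end; case: ifP => kj; rewrite xpair_eqE ?andbT ?andbF.
      by have := k0 _ kj; case: j kj => //= j kj _; rewrite eqSS [j == i]eq_sym; case: eqP => [->|]; rewrite ?kj ?andbF.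
    by case: eqP => [ji|_]; rewrite ?andbF //; move: kj; rewrite ji /= => ->.
  rewrite (@count_iota_pred1 _ (~~ k i.-1) i) 1?andbC // => j.
  rewrite /second_end; case: ifP => kj; rewrite xpair_eqE ?andbF ?andbT.
    by case: (j =P i) kj => [->|_]; rewrite ?andbF // => ->.
  by rewrite [i == j]eq_sym; case: (j =P i) kj => [->|_]; rewrite ?andbF // => ->.
rewrite !toCount rungs !countU => [|j|j]; last 2 first.
- by rewrite /= /second_end; case: ifP => _; rewrite !xpair_eqE; lia.
- by rewrite /= !xpair_eqE; lia.
rewrite starts !into (@count_iota_pred1 _ b i) => [|j]; last first.
  by rewrite xpair_eqE; case: (b); rewrite ?andbF ?andbT ?[i == j]eq_sym.
move: (f i.-1) => fi /=; case: (b) fi => [] []; lia.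
Qed.
End Ladder.

(** * A chain is a ladder *)

Lemma map_uniq_inj (T T' : eqType) (f : T -> T') (s : seq T) (x y : T) :
  uniq (map f s) -> x \in s -> y \in s -> f x = f y -> x = y.
Proof.
elim: s => //= z s IH /andP[zs us]; rewrite !inE => /predU1P[->|xs] /predU1P[->|ys] fxy //.
- by rewrite fxy map_f in zs.
- by rewrite -fxy map_f in zs.
exact: IH.
Qed.

Section ChainLadder.
Variables (G : lattice_graph) (n : nat) (C : seq cell).
Hypothesis chain : polyomino_chain G n C.
Hypothesis n3 : (2 < n)%N.

Definition turn j : bool := (0 < j < n.-1)%N && turns C`_j.-1 C`_j.+1.

(** No flip is needed in the first square: the order of its two entering corners
    is free, and [start_pivot] below fixes it. *)
Definition flips j (p : point) : bool :=
  [&& (0 < j)%N, ~~ turn j, turn j.+1 & opposite C`_j p \in corners C`_j.+2].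

Variable start : point * point.

Definition exit j (e : point * point) : point * point :=
  let p' := opposite C`_j e.2 in let q' := opposite C`_j e.1 in
  if flips j e.1 then (q', p') else (p', q').

Fixpoint entry j : point * point :=
  if j is i.+1 then
    ((exit i (entry i)).1, if turn i then (entry i).1 else (exit i (entry i)).2)
  else start.

Definition flip j := flips j (entry j).1.

Definition label_point (a : label) : point :=
  if a.1 is i.+1 then (if a.2 then (exit i (entry i)).1 else (exit i (entry i)).2)
  else (if a.2 then start.1 else start.2).

Hypothesis start_side : lattice_adj start.1 start.2.
Hypothesis start_corners : on_side C`_0 C`_0 start.
Hypothesis start_far : (start.1 \notin corners C`_1) /\ (start.2 \notin corners C`_1).
Hypothesis start_pivot : turn 1 -> opposite C`_0 start.2 \in corners C`_2.

Record entry_spec j : Prop := EntrySpec {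
  entry_adj : lattice_adj (entry j).1 (entry j).2;
  entry_in : (entry j).1 \in corners C`_j /\ (entry j).2 \in corners C`_j;
  entry_prev : (0 < j)%N -> on_side C`_j.-1 C`_j (entry j);
  entry_turn : turn j -> (entry j).1 \in corners C`_j.+1 /\ (entry j).2 \notin corners C`_j.+1;
  entry_straight : (j.+1 < n)%N -> ~~ turn j ->
    (entry j).1 \notin corners C`_j.+1 /\ (entry j).2 \notin corners C`_j.+1 }.

Lemma chain_next j : (j.+1 < n)%N -> lattice_adj C`_j C`_j.+1.
Proof. by move=> jn; rewrite (chain_adj chain) ?eqxx // ltnW. Qed.

Lemma chain_skip j : (j.+2 < n)%N -> C`_j != C`_j.+2.
Proof. by move=> jn; rewrite (chain_eq chain) //; lia. Qed.

Lemma chain_far j :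
  (0 < j)%N -> (j.+2 < n)%N -> lattice_adj C`_j.-1 C`_j.+2 = false.
Proof. by move=> j0 jn; rewrite (chain_adj chain); lia. Qed.

Lemma turn_lt j : turn j -> (0 < j < n.-1)%N.
Proof. by case/andP. Qed.

(** After a turn the next pivot is the new corner: if it were the old pivot again,
    four consecutive squares would surround it.  After a straight square a flip
    gives the right name to the next pivot. *)
Lemma exit_side j : (j.+1 < n)%N -> entry_spec j ->
  let e := entry j.+1 in
  [/\ lattice_adj e.1 e.2, on_side C`_j C`_j.+1 e
    & turn j.+1 -> e.1 \in corners C`_j.+2].
Proof.
move=> jn [adjj [pj qj] prev tj sj] e; rewrite /e /= /exit -/(flip j).
have cd := chain_next jn.
have pin := opposite_corner pj; have qin := opposite_corner qj.
case Tj: (turn j).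
  have [pd qd] := tj Tj.
  have -> : flip j = false by rewrite /flip /flips Tj andbF.
  have p'd := pivot_opposite cd pj qj adjj pd qd.
  have side : on_side C`_j C`_j.+1 (opposite C`_j (entry j).2, (entry j).1).
    by rewrite /on_side /= qin pj p'd pd.
  have adj' : lattice_adj (opposite C`_j (entry j).2) (entry j).1.
    by rewrite lattice_adj_sym; exact: adj_opposite.
  split=> //= Tj1; have /andP[_ j1n] := turn_lt Tj1.
  have j2n : (j.+2 < n)%N by rewrite -ltn_predRL.
  have T : turns C`_j C`_j.+2 by case/andP: Tj1.
  apply: contraT => p'N.
  have /andP[j0 _] := turn_lt Tj.
  have pdd : (entry j).1 \in corners C`_j.+2.
    by rewrite (turn_pivot cd (chain_next j2n) T side adj').
  have /and4P[/= pb _ _ _] := prev j0.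
  have bc : lattice_adj C`_j.-1 C`_j by rewrite -{2}(prednK j0) chain_next // prednK // ltnW.
  have bne : C`_j.-1 != C`_j.+1 by have := @chain_skip j.-1; rewrite prednK //; apply.
  have := no_block bc cd (chain_next j2n) bne (chain_skip j2n) pb pj pd pdd.
  by rewrite chain_far.
have [pd qd] := sj jn (negbT Tj).
have /andP[q'd p'd] := far_opposite cd pj qj adjj pd qd.
have adj' : lattice_adj (opposite C`_j (entry j).2) (opposite C`_j (entry j).1).
  by apply: opposite_side; rewrite lattice_adj_sym.
have side : on_side C`_j C`_j.+1 (opposite C`_j (entry j).2, opposite C`_j (entry j).1).
  by rewrite /on_side /= qin pin p'd q'd.
case Fj: (flip j); split=> //=.
- by rewrite lattice_adj_sym.
- by move: side; rewrite /on_side /= => /and4P[-> -> -> ->].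
- by case/and4P: Fj.
move=> Tj1; have /andP[_ j1n] := turn_lt Tj1.
case: (posnP j) => [j0|j0].
  by move: Tj1; rewrite j0 /=; exact: start_pivot.
move: Fj; rewrite /flip /flips j0 Tj Tj1 /= => q'N.
have j2n : (j.+2 < n)%N by rewrite -ltn_predRL.
have T : turns C`_j C`_j.+2 by case/andP: Tj1.
by have := turn_pivot cd (chain_next j2n) T side adj'; rewrite q'N => /esym/negbFE.
Qed.

Lemma entryP j : (j < n)%N -> entry_spec j.
Proof.
elim: j => [_|j IH jn].
  have [s1 s2 _ _] := and4P start_corners.
  by split=> //.
have [adje side pivot] := exit_side jn (IH (ltnW jn)).
have [e1j e2j e1j1 e2j1] := and4P side.
have cd := chain_next jn.
split=> // [Tj|j2n Tj].
  have e1d := pivot Tj; split=> //.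
  have /andP[_ j1n] := turn_lt Tj; have j2n : (j.+2 < n)%N by rewrite -ltn_predRL.
  have T : turns C`_j C`_j.+2 by case/andP: Tj.
  by rewrite (turn_pivot cd (chain_next j2n) T _ adje) ?e1d.
have NT : ~~ turns C`_j C`_j.+2 by move: Tj; rewrite /turn /=; case: turns => //; rewrite andbT ltn_predRL j2n.
have far := straight_far cd (chain_next j2n) (chain_skip j2n) NT.
by split; exact: far.
Qed.

Local Notation corner_labels := (square_labels turn flip).

Lemma label_entry j : (entry j).1 = label_point (j, true) /\
  (entry j).2 = label_point (second_end turn j).
Proof.
case: j => [|j]; first by [].
rewrite /second_end /=; split=> //; case: ifP => //= _.
by case: j.
Qed.

Lemma label_exit j : label_point (j.+1, ~~ flip j) = opposite C`_j (entry j).2 /\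
  label_point (j.+1, flip j) = opposite C`_j (entry j).1.
Proof. by rewrite /label_point /= /exit -/(flip j); case: (flip j). Qed.

Lemma square_labelsE j : map label_point (corner_labels j) =
  [:: (entry j).1; (entry j).2; opposite C`_j (entry j).2; opposite C`_j (entry j).1].
Proof.
rewrite /square_labels /=.
by have [-> ->] := label_exit j; have [-> ->] := label_entry j.
Qed.

Lemma corner_label j x : (j < n)%N ->
  (x \in corners C`_j) = (x \in map label_point (corner_labels j)).
Proof.
move=> jn; have E := entryP jn; have [pj qj] := entry_in E.
by rewrite square_labelsE; exact: corners_opposite pj qj (entry_adj E).
Qed.

Lemma label_in j b : (j < n)%N -> label_point (j.+1, b) \in corners C`_j.
Proof.
by move=> jn; rewrite corner_label // map_f // !inE; case: b; case: (flip j); rewrite eqxx ?orbT.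
Qed.

Lemma label_in0 b : label_point (0%N, b) \in corners C`_0.
Proof. by case/and4P: start_corners; case: b. Qed.

Lemma label_new i j b : (i < j < n)%N -> label_point (j.+1, b) \notin corners C`_i.
Proof.
move=> /andP[ij jn]; have [x xp] := square_corner (chain_square chain jn) (label_in b jn).
have j0 : (0 < j)%N by exact: leq_ltn_trans ij.
rewrite -xp; apply: (far_corner_new chain (j := j)); rewrite ?ij //.
  by rewrite /vertex_of xp label_in.
rewrite /vertex_of xp; have E := entryP jn.
have jn' : (j.-1.+1 < n)%N by rewrite prednK.
have bc : lattice_adj C`_j.-1 C`_j by rewrite -{2}(prednK j0) chain_next.
have side := entry_prev E j0; have adje := entry_adj E.
rewrite [entry j]surjective_pairing in side.
have [f1 f2] := opposite_far bc side adje.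
have [l1 l2] := label_exit j.
by case: (b); case: (flip j) l1 l2 => /= l1 l2; rewrite ?l1 ?l2.
Qed.

Lemma square_labels_inj j a b : (j < n)%N -> a \in corner_labels j ->
  b \in corner_labels j -> label_point a = label_point b -> a = b.
Proof.
move=> jn; apply: map_uniq_inj; rewrite square_labelsE.
have E := entryP jn; have [pj qj] := entry_in E.
exact: opposite_uniq pj qj (entry_adj E).
Qed.

Lemma turn0 : turn 0 = false. Proof. by []. Qed.

Lemma mem_square_labels0 b : (0%N, b) \in corner_labels 0.
Proof. by rewrite !inE /second_end turn0 !xpair_eqE; case: b. Qed.

Lemma mem_square_labels j b : (j.+1, b) \in corner_labels j.
Proof. by rewrite !inE !xpair_eqE eqxx; case: b; case: (flip j); rewrite !orbT. Qed.

(** Labels born with different squares are separated by [label_new]. *)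
Lemma label_inj a b : (a.1 <= n)%N -> (b.1 <= n)%N ->
  label_point a = label_point b -> a = b.
Proof.
wlog: a b / (a.1 <= b.1)%N => [W an bn ab|].
  by case: (leqP a.1 b.1) => h; [apply: W | apply/esym/W => //; exact: ltnW].
have n0 : (0 < n)%N by exact: leq_trans n3.
case: a b => [i b] [[|j] b'] /= ij _ jn E.
  by move: ij E; rewrite leqn0 => /eqP-> E; apply: (@square_labels_inj 0); rewrite ?mem_square_labels0.
move: ij; rewrite leq_eqVlt => /predU1P[ij|ij].
  by rewrite ij in E *; apply: (@square_labels_inj j); rewrite ?mem_square_labels.
case: i ij E => [|i] ij E.
  case: (posnP j) => [j0|j0].
    rewrite j0 in E *.
    by apply: (@square_labels_inj 0); rewrite ?mem_square_labels0 ?mem_square_labels.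
  by have := @label_new 0 j b'; rewrite j0 jn -E label_in0 => /(_ isT).
have := @label_new i j b'; rewrite -ltnS ij jn -E label_in; first by move/(_ isT).
by apply: leq_trans jn; rewrite ltnW.
Qed.

Lemma corner_has_label j x : (j < n)%N -> x \in corners C`_j ->
  exists2 a, a \in corner_labels j & x = label_point a.
Proof. by move=> jn; rewrite corner_label // => /mapP. Qed.

Lemma square_labels_le j a : (j < n)%N -> a \in corner_labels j -> (a.1 <= n)%N.
Proof.
move=> jn; rewrite !inE => /or4P[] /eqP-> //=; first exact: ltnW.
rewrite /second_end; case: ifP => _ /=; last exact: ltnW.
exact: leq_trans (leq_pred j) (ltnW jn).
Qed.

Lemma label_corner a :
  (a.1 <= n)%N -> exists2 j, (j < n)%N & label_point a \in corners C`_j.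
Proof.
have n0 : (0 < n)%N by exact: leq_trans n3.
case: a => [[|j] b] /= jn; first by exists 0%N; rewrite ?label_in0.
by exists j; rewrite ?label_in.
Qed.

Lemma label_vertex :
  {v : label -> G | forall a, (a.1 <= n)%N -> pos (v a) = label_point a}.
Proof.
have n0 : (0 < n)%N by exact: leq_trans n3.
have ex a : exists x : G, (a.1 <= n)%N ==> (pos x == label_point a).
  case: leqP => an /=; last by have [x _] := square_corner (chain_square chain n0) (label_in0 true); exists x.
  have [j jn aj] := label_corner an.
  by have [x <-] := square_corner (chain_square chain jn) aj; exists x.
exists (fun a => xchoose (ex a)) => a an.
by move/implyP: (xchooseP (ex a)) => /(_ an)/eqP.
Qed.

Local Notation rails := (ladder_edges n turn flip).

Lemma entry_ladder_edge j : (j < n)%N ->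
  (((j, true), second_end turn j) \in rails) || ((second_end turn j, (j, true)) \in rails).
Proof.
move=> jn; case: j jn => [|j] jn; rewrite /second_end /=.
  by [].
case: ifP => Tj; last first.
  by apply/orP; left; apply/mem_ladder_edges; constructor 1; exists j.+1; rewrite // ltnW.
apply/orP; right; apply/mem_ladder_edges; constructor 2; exists j; first exact: ltnW.
by rewrite /pivot_rail /flip /flips Tj andbF.
Qed.

Lemma square_labels_adj j : (j < n)%N ->
  [/\ lattice_adj (label_point (j, true)) (label_point (second_end turn j)),
      lattice_adj (label_point (j, true)) (label_point (j.+1, ~~ flip j)),
      lattice_adj (label_point (second_end turn j)) (label_point (j.+1, flip j))
    & lattice_adj (label_point (j.+1, ~~ flip j)) (label_point (j.+1, flip j))].
Proof.
move=> jn; have E := entryP jn; have [pj qj] := entry_in E; have pq := entry_adj E.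
have qp : lattice_adj (entry j).2 (entry j).1 by rewrite lattice_adj_sym.
have [<- <-] := label_entry j; have [-> ->] := label_exit j.
by split; [| apply: adj_opposite | apply: adj_opposite | apply: opposite_side].
Qed.

Lemma ladder_edge_square e :
  e \in ladder_edges n turn flip -> exists2 j, (j < n)%N &
  [/\ e.1 \in corner_labels j, e.2 \in corner_labels j
    & lattice_adj (label_point e.1) (label_point e.2)].
Proof.
have n0 : (0 < n)%N by exact: leq_trans n3.
case/mem_ladder_edges => -[j jn ->] /=.
- case: j jn => [|j] jn; [by exists 0%N | exists j => //].
  split; rewrite ?mem_square_labels //; have [_ _ _] := square_labels_adj jn.
  by case: (flip j); rewrite // lattice_adj_sym.
- exists j => //; split; rewrite ?mem_square_labels ?mem_head //.
  by have [] := square_labels_adj jn.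
- exists j => //; split; rewrite ?mem_square_labels //; first by rewrite !inE eqxx orbT.
  by have [] := square_labels_adj jn.
Qed.

Lemma square_adj_ladder_edge j a b : (j < n)%N -> a \in corner_labels j ->
  b \in corner_labels j -> lattice_adj (label_point a) (label_point b) ->
  ((a, b) \in rails) || ((b, a) \in rails).
Proof.
move=> jn aj bj ab; have Ej := entryP jn; have [pj qj] := entry_in Ej.
have [pE qE] := label_entry j; have [q'E p'E] := label_exit j.
have notpp' : lattice_adj (label_point (j, true)) (label_point (j.+1, flip j)) = false.
  by rewrite p'E -pE opposite_not_adj.
have notqq' : lattice_adj (label_point (second_end turn j)) (label_point (j.+1, ~~ flip j)) = false.
  by rewrite q'E -qE opposite_not_adj.
pose joined x y := ((x, y) \in rails) || ((y, x) \in rails).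
have joinedC x y : joined x y = joined y x by exact: orbC.
have first : joined (j, true) (j.+1, ~~ flip j).
  by apply/orP; left; apply/mem_ladder_edges; constructor 2; exists j.
have second : joined (second_end turn j) (j.+1, flip j).
  by apply/orP; left; apply/mem_ladder_edges; constructor 3; exists j.
have last : joined (j.+1, ~~ flip j) (j.+1, flip j).
  have r : rung j.+1 \in rails by apply/mem_ladder_edges; constructor 1; exists j.+1.
  by rewrite /joined; case: (flip j); rewrite /= -/(rung _) r ?orbT.
have entryE : joined (j, true) (second_end turn j) by exact: entry_ladder_edge.
rewrite -/(joined a b); clearbody joined.
have irr x : lattice_adj x x = false by apply/negP => /lattice_adj_neq; rewrite eqxx.
move: aj bj ab; rewrite !inE => /or4P[] /eqP-> /or4P[] /eqP->;
  rewrite ?irr ?notpp' ?notqq' //;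
  rewrite 1?lattice_adj_sym ?notpp' ?notqq' // => _; by rewrite joinedC.
Qed.

Lemma ladder_of_entries : exists v : label -> G, ladder n turn flip v /\
  forall j x, (j < n)%N -> vertex_of C`_j x = (x \in map v (corner_labels j)).
Proof.
have [v vP] := label_vertex; exists v.
have n0 : (0 < n)%N by exact: leq_trans n3.
have sqv j x : (j < n)%N -> vertex_of C`_j x = (x \in map v (corner_labels j)).
  move=> jn; apply/idP/mapP => [/(corner_has_label jn)[a aj xa]|[a aj ->]].
    exists a => //; apply: (@pos_inj G); rewrite xa vP //; exact: square_labels_le aj.
  rewrite /vertex_of vP ?corner_label ?map_f //; exact: square_labels_le aj.
split=> //; split.
- by move=> a b an bn /(congr1 (@pos G)); rewrite !vP //; exact: label_inj.
- move=> x; have [j jn] := chain_vertex chain x; rewrite sqv // => /mapP[a aj ->].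
  by exists a => //; exact: square_labels_le aj.
- move=> a b an bn; apply/idP/idP => [ab|].
    have [j jn /and3P[_ aj bj]] := chain_edge chain ab.
    have mem c : (c.1 <= n)%N -> vertex_of C`_j (v c) -> c \in corner_labels j.
      move=> cn; rewrite /vertex_of vP // => /(corner_has_label jn)[c' c'j E].
      by rewrite (label_inj cn (square_labels_le jn c'j) E).
    apply: (square_adj_ladder_edge jn) (mem _ an aj) (mem _ bn bj) _.
    by rewrite -!vP //; exact: pos_adj.
  have adjE e : e \in ladder_edges n turn flip -> adj (v e.1) (v e.2).
    case/ladder_edge_square => j jn [e1 e2 e12].
    have [le1 le2] := (square_labels_le jn e1, square_labels_le jn e2).
    apply: (square_adj (chain_square chain jn)); rewrite ?sqv ?map_f //.
    by rewrite !vP.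
  by case/orP => /adjE //=; rewrite adj_sym.
- by move=> j /turn_lt.
- by move=> j /and4P[].
Qed.
End ChainLadder.

(** * Kinks, segments and flips *)

Section Kinks.
Variables (G : lattice_graph) (n : nat) (C : seq cell).
Hypothesis chain : polyomino_chain G n C.
Local Notation turn := (turn n C).

(** If the second square turns, the first side is ordered so that its first end is
    the one on the side of that pivot. *)
Lemma chain_ladder :
  (2 < n)%N -> exists f, exists v : label -> G, ladder n turn f v /\
  forall j x, (j < n)%N -> vertex_of C`_j x =
    (x \in map v (square_labels turn f j)).
Proof.
move=> n3; have c01 : lattice_adj C`_0 C`_1 by apply: (chain_next chain); exact: ltnW.
have [p [q [pq [p0 q0] [p1 q1]]]] := far_side c01.
suff [s [s1 s2 s3 s4]] : exists s : point * point, [/\ lattice_adj s.1 s.2,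
    on_side C`_0 C`_0 s, s.1 \notin corners C`_1 /\ s.2 \notin corners C`_1 &
    turn 1 -> opposite C`_0 s.2 \in corners C`_2].
  by exists (flip n C s); exact (ladder_of_entries chain n3 s1 s2 s3 s4).
have [T1|T1] := boolP (turn 1 ==> (opposite C`_0 q \in corners C`_2)).
  by exists (p, q); split; rewrite /on_side ?p0 ?q0 //; exact/implyP.
move: T1; rewrite negb_imply => /andP[T1 q2].
exists (q, p); split; rewrite /on_side ?p0 ?q0 //=; first by rewrite lattice_adj_sym.
move=> _; have /andP[p'1 q'1] := far_opposite c01 p0 q0 pq p1 q1.
have T : turns C`_0 C`_2 by case/andP: T1.
have c12 : lattice_adj C`_1 C`_2 by exact: (chain_next chain).
have side : on_side C`_0 C`_1 (opposite C`_0 q, opposite C`_0 p).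
  by rewrite /on_side /= !opposite_corner // p'1 q'1.
by rewrite (turn_pivot c01 c12 T side) // opposite_side // lattice_adj_sym.
Qed.

Lemma inner_degree j : (0 < j < n.-1)%N -> count (adjacent G C`_j) C = 2%N.
Proof.
case/andP=> j0 jn; case: (chain) => _ sz _ _ adjE.
have CE : C = mkseq (nth 0 C) n by rewrite -sz mkseq_nth.
rewrite [X in count _ X]CE count_map.
rewrite (eq_in_count (a2 := predU (pred1 j.+1) (pred1 j.-1))) => [|i]; last first.
  by rewrite mem_iota => iln; rewrite /= adjE //; lia.
rewrite -[LHS]addn0 -[X in (_ + X)%N](@count_pred0 _ (iota 0 n)).
have <- : count (predI (pred1 j.+1) (pred1 j.-1)) (iota 0 n) = count pred0 (iota 0 n).
  by apply: eq_count => i /=; lia.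
by rewrite count_predUI !(count_uniq_mem _ (iota_uniq _ _)) !mem_iota; lia.
Qed.

Section Labelled.
Variables (f : nat -> bool) (v : label -> G).
Hypothesis lad : ladder n turn f v.
Hypothesis sqv : forall j x, (j < n)%N -> vertex_of C`_j x =
    (x \in map v (square_labels turn f j)).

(** The corner of a turning square that is off both shared sides belongs to no
    other square. *)
Lemma turn_kink j : turn j -> kink G C C`_j.
Proof.
move=> Tj; have jn := turn_lt Tj.
have jn' : (j.+1 < n)%N by rewrite -ltn_predRL; case/andP: jn.
split; first by split; [rewrite mem_nth ?(chain_size chain) // ltnW | exact: inner_degree].
exists (v (j.+1, false)); last by rewrite (ladder_deg lad) ?(ltnW jn') //= Tj andbF.
rewrite sqv ?map_f ?(ltnW jn') //; case fj: (f j); last by rewrite /square_labels fj !inE eqxx !orbT.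
by have [_] := ladder_flip lad fj; rewrite Tj.
Qed.

(** Each corner of a straight inner square is on one of its two shared sides, so it
    lies on at least two squares. *)
Lemma kink_turn j : (0 < j < n.-1)%N -> kink G C C`_j -> turn j.
Proof.
move=> jn [_ [x xj dx]]; apply: contraT => nT; case/andP: jn => j0 jn.
have jn' : (j.+1 < n)%N by rewrite -ltn_predRL.
have jn1 := ltnW jn'; have jn2 := ltnW jn1.
have kP i : turn i -> (0 < i)%N by case/turn_lt/andP.
move: xj; rewrite sqv // => /mapP[a + xa]; move: dx; rewrite {x}xa /square_labels !inE => da.
have dE : forall i b, (i <= n)%N -> deg (v (i, b)) = _ := ladder_deg lad.
case/or4P => /eqP aE; move: da; rewrite {a}aE.
- by rewrite dE // j0 jn1.
- rewrite /second_end; case: ifP => Tj.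
    rewrite dE; last exact: leq_trans (leq_pred _) jn2.
    by rewrite (kP _ Tj) Tj; case: (_ < n)%N; lia.
  by rewrite dE // j0 jn1 Tj.
- by rewrite dE // jn' /= nT; case: (f j); case: turn.
- by rewrite dE // jn' /= nT; case: (f j); case: turn.
Qed.

(** A turn just before a flip makes the straight square [j] the middle of an
    internal segment of length three whose pivots lie on the same side of the
    chain; the rail on the other side then joins two vertices of degree three. *)
Lemma flip_regular j :
  (forall a b, internal_segment G C a b -> segment_length a b = 3%N ->
      ~ exists i, exists x : G, exists y : G,
          [/\ (a <= i <= b)%N, edge_of C`_i x y, deg x = 3%N & deg y = 3%N]) ->
  f j -> ~~ turn j.-1.
Proof.
move=> omega fj; apply/negP => Tj'; have [j0 nTj Tj1] := ladder_flip lad fj.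
have /andP[j'0 _] := turn_lt Tj'; have /andP[_ j1n] := turn_lt Tj1.
have sz := chain_size chain.
have jn : (j < n.-1)%N by exact: ltnW.
have jn' : (j.+1 < n)%N by rewrite -ltn_predRL.
have jn1 := ltnW jn'; have jn2 := ltnW jn1.
apply: (omega j.-1 j.+1); last first.
- have dx : deg (v (j, true)) = 3%N by rewrite (ladder_deg lad) // j0 jn1 (negPf nTj).
  have dy : deg (v (j.+1, false)) = 3%N by rewrite (ladder_deg lad) // jn' /= nTj.
  exists j, (v (j, true)), (v (j.+1, false)); split=> //; first by rewrite leq_pred leqnSn.
  have xj : vertex_of C`_j (v (j, true)) by rewrite sqv // map_f // mem_head.
  have yj : vertex_of C`_j (v (j.+1, false)).
    by rewrite sqv // map_f // /square_labels fj !inE eqxx !orbT.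
  rewrite /edge_of xj yj !andbT (ladder_adj lad) //; apply/orP; left; apply/mem_ladder_edges.
  by constructor 2; exists j; rewrite // /pivot_rail fj.
- by rewrite /segment_length; lia.
split=> //; last by rewrite sz -ltn_predRL.
split; first split.
- by rewrite sz jn' andbT; lia.
- move=> i ij kij; have ijE : i = j by lia.
  by move: kij; rewrite ijE => /kink_turn; rewrite j0 jn => /(_ isT); apply/negP.
move=> a b aj bj [/andP[ab bC] straight]; split; apply/eqP.
  rewrite eqn_leq aj leqNgt; apply/negP => lt.
  by apply: (straight j.-1); [rewrite lt; lia | exact: turn_kink].
rewrite eqn_leq bj leqNgt andbT; apply/negP => lt.
by apply: (straight j.+1); [rewrite lt andbT; lia | exact: turn_kink].
Qed.

End Labelled.
End Kinks.

(** * The index of a ladder *)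

Lemma ladder_isomorphic (G H : sgraph) n k f v k' f' v' :
  @ladder G n k f v -> @ladder H n k' f' v' -> k =1 k' -> f =1 f' -> isomorphic G H.
Proof.
move=> lad lad' kk ff.
have EE : ladder_edges n k f = ladder_edges n k' f'.
  congr (_ ++ (_ ++ _)); apply: eq_map => j; first by rewrite /pivot_rail ff.
  by rewrite /second_rail /second_end kk ff.
have ex (G0 : sgraph) k0 f0 v0 (x : G0) : @ladder G0 n k0 f0 v0 ->
    exists a : label, (a.1 <= n)%N && (v0 a == x).
  by move=> h; have [a an <-] := ladder_onto h x; exists a; rewrite an eqxx.
pose g x := xchoose (ex _ _ _ _ x lad); pose g' x := xchoose (ex _ _ _ _ x lad').
have gP x : ((g x).1 <= n)%N /\ v (g x) = x.
  by case/andP: (xchooseP (ex _ _ _ _ x lad)) => -> /eqP.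
have g'P x : ((g' x).1 <= n)%N /\ v' (g' x) = x.
  by case/andP: (xchooseP (ex _ _ _ _ x lad')) => -> /eqP.
exists (fun x => v' (g x)) => [|x y]; last first.
  have [[gx vx] [gy vy]] := (gP x, gP y).
  by rewrite (ladder_adj lad') // -EE -(ladder_adj lad) // vx vy.
exists (fun x => v (g' x)) => x.
  have [[gx vx] [gy vy]] := (gP x, g'P (v' (g x))).
  by rewrite (ladder_inj lad' gy gx vy) vx.
have [[gx vx] [gy vy]] := (g'P x, gP (v (g' x))).
by rewrite (ladder_inj lad gy gx vy) vx.
Qed.

Section IndexFormula.
Local Open Scope nat_scope.
Variables (T : Type) (idx : T) (op : Monoid.com_law idx) (F : nat -> nat -> T).

Definition weight a b := F (a + b) (a * b).

Lemma weightC a b : weight a b = weight b a.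
Proof. by rewrite /weight addnC mulnC. Qed.

(** A terminal square contributes its three free edges and the side that it shares
    with its neighbour; the last weight is an edge of the neighbour, which turns
    iff [a]. *)
Definition end_term (a : bool) : T :=
  op (op (op (weight 2 2) (weight 2 3)) (weight 2 (3 + a)))
     (op (weight 3 (3 + a)) (weight 3 (3 - a))).

(** The side shared by two consecutive inner squares, which turn iff [a] and [b],
    and one further edge of each of them. *)
Definition pair_term (a b : bool) : T :=
  op (op (weight (3 + a) (3 + b)) (weight (3 - a) (3 + b))) (weight (3 + a) (3 - b)).

Lemma pair_termC a b : pair_term a b = pair_term b a.
Proof.
rewrite /pair_term [weight (3 + a) (3 + b)]weightC [weight (3 - a) _]weightC.
by rewrite [weight (3 + a) (3 - b)]weightC Monoid.mulmAC.
Qed.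

Definition term m (k : nat -> bool) j : T :=
  if j == 0 then end_term (k 1) else
  if j == m.+1 then end_term (k m.+1) else pair_term (k j) (k j.+1).

(** The three edges that square [j] adds depend on whether squares [j.-1], [j] and
    [j.+1] turn, but each of them only on two consecutive ones, and regrouping
    by these pairs gives the terms.  A flip exchanges the younger ends of the two
    rails of a square; the older ends both have degree three, so the combined
    weight of the two rails stays the same. *)
Lemma ladder_index (G : sgraph) m k f v : @ladder G m.+3 k f v ->
  (forall j, f j -> ~~ k j.-1) ->
  edge_index op idx F G = \big[op/idx]_(0 <= j < m.+2) term m k j.
Proof.
move=> lad reg.
pose dp j := deg (v (j, true)); pose dr j := deg (v (j, false)).
pose dq j := deg (v (second_end k j)).
have wE e : e \in ladder_edges m.+3 k f ->
    F (dsum [set v e.1; v e.2]) (dprod [set v e.1; v e.2]) = weight (deg (v e.1)) (deg (v e.2)).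
  by move/(ladder_edge_neq lad) => ne; rewrite dsum_edge ?dprod_edge.
have kP j : k j -> 0 < j < m.+2 by move/(ladder_turn lad).
have kF j : ~~ (0 < j < m.+2) -> k j = false by move=> h; apply: contraNF h => /kP.
have k_0 : k 0 = false by exact: kF.
have k_n : k m.+2 = false by apply: kF; rewrite ltnn.
have dp0 : dp 0 = 2 by rewrite /dp (ladder_deg lad) // kF.
have dr0 : dr 0 = 2 by rewrite /dr (ladder_deg lad) // kF.
have dpS j : j < m.+2 -> dp j.+1 = 3 + k j.+1.
  by move=> jm; rewrite /dp (ladder_deg lad) //=; lia.
have drS j : j < m.+2 -> dr j.+1 = 3 - k j.
  by move=> jm; rewrite /dr (ladder_deg lad) //=; lia.
have dpn : dp m.+3 = 2 by rewrite /dp (ladder_deg lad) //= kF; lia.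
have drn : dr m.+3 = 2 by rewrite /dr (ladder_deg lad) //=; lia.
have dq0 : dq 0 = 2 by rewrite /dq /second_end kF.
have dqS j : j < m.+2 -> dq j.+1 = 3 + k j.
  rewrite /dq /second_end /=; case: ifP => kj jm; last by rewrite -/(dr _) drS // kj.
  by case: j kj jm => [|j] kj jm; [rewrite kF in kj | rewrite -/(dp _) dpS ?kj //; lia].
pose t j := op (weight (dp j.+1) (dr j.+1)) (op (weight (dp j) (dp j.+1)) (weight (dq j) (dr j.+1))).
transitivity (op (weight 2 2) (\big[op/idx]_(0 <= j < m.+3) t j)).
  have iotaE p : iota 0 p = index_iota 0 p by rewrite /index_iota subn0.
  rewrite /edge_index (big_ladder_edges lad) (eq_big_seq _ wE) !big_cat !big_map.
  rewrite !iotaE big_nat_recl // -Monoid.mulmA /t big_split /=.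
  congr (op _ (op _ _)); first by rewrite -/(dp 0) -/(dr 0) dp0 dr0.
  etransitivity; first by symmetry; apply: big_split.
  apply: eq_big_nat => j /andP[_ jn]; rewrite -/(dp j) -/(dq j).
  (* at a flip both older ends have degree 3, and the two rails trade weights *)
  case fj: (f j); rewrite -/(dp j.+1) -/(dr j.+1) //.
  have [j0 kj _] := ladder_flip lad fj; have k'j := reg _ fj.
  case: j j0 jn kj k'j {fj} => //= j _ jn kj k'j.
  have jm : j < m.+2 by lia.
  have -> : dp j.+1 = 3 by rewrite dpS // (negPf kj).
  have -> : dq j.+1 = 3 by rewrite dqS // (negPf k'j).
  exact: Monoid.mulmC.
pose X j := op (weight (3 + k j) (3 + k j.+1)) (weight (3 - k j) (3 + k j.+1)).
pose Y j := weight (3 + k j) (3 - k j.+1).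
rewrite big_nat_recl // big_nat_recr //=.
rewrite [X in op _ (op _ (op X _))](eq_big_nat _ _ (F2 := fun j => op (X j.+1) (Y j))) => [|j /andP[_ jm]]; last first.
  have jm1 : j < m.+2 by lia.
  rewrite /t !dpS ?drS ?dqS // Monoid.mulmA; congr (op _ _).
  rewrite weightC; exact: Monoid.mulmC.
rewrite big_split /= [X in op _ (op _ (op (op _ X) _))]big_nat_recl // [X in op _ (op _ (op (op X _) _))]big_nat_recr //=.
rewrite big_nat_recl // big_nat_recr //=.
rewrite [X in _ = op _ (op X _)](eq_big_nat _ _ (F2 := fun j => op (X j.+1) (Y j.+1))); last first.
  by move=> j /andP[_ jm]; rewrite /term /= eqSS ltn_eqF.
rewrite big_split /= /term eqxx /=.
have -> : t 0 = op (weight 3 (3 + k 1)) (op (weight 2 (3 + k 1)) (weight 2 3)).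
  by rewrite /t dpS // drS // dp0 dq0 k_0 [weight (3 + _) _]weightC.
have -> : t m.+2 = op (weight 2 2) (op (weight 2 3) (weight 2 (3 + k m.+1))).
  by rewrite /t dpn drn dpS // dqS // k_n ?addn0 [weight 3 2]weightC [weight (3 + _) 2]weightC.
have -> : X m.+1 = op (weight 3 (3 + k m.+1)) (weight 3 (3 - k m.+1)).
  by rewrite /X k_n addn0 weightC [weight (_ - _) _]weightC.
have -> : Y 0 = weight 3 (3 - k 1) by rewrite /Y k_0.
rewrite eqxx /end_term.
rewrite !Monoid.mulmA.
by rewrite [LHS](op.[ACl 1*4*3*2*8*5*9*10*11*12*6*7]).
Qed.
End IndexFormula.

(** * Comparing indices turn by turn *)

(** The relation [lt] will be [<] for sums of reals and [>] for products of natural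
    numbers, and [mono] a set of values on which [op] is strictly monotone. *)
Section Comparison.
Local Open Scope nat_scope.
Variables (T : eqType) (idx : T) (op : Monoid.com_law idx) (F : nat -> nat -> T).
Variables (mono : pred T) (lt : rel T).
Hypothesis lt_irr : irreflexive lt.
Hypothesis lt_trans : transitive lt.
Hypothesis pos_idx : mono idx.
Hypothesis pos_op : forall a b, mono a -> mono b -> mono (op a b).
Hypothesis lt_op : forall a b c, mono c -> lt a b -> lt (op c a) (op c b).
Hypothesis pos_F : forall a b, (0 < a)%N -> (0 < b)%N -> mono (F a b).

Let le a b := (a == b) || lt a b.

Lemma lt_big (I : eqType) (s : seq I) (f g : I -> T) :
  (forall i, i \in s -> [/\ mono (f i), mono (g i) & le (f i) (g i)]) ->
  if has (fun i => lt (f i) (g i)) s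
  then is_true (lt (\big[op/idx]_(i <- s) f i) (\big[op/idx]_(i <- s) g i))
  else \big[op/idx]_(i <- s) f i = \big[op/idx]_(i <- s) g i.
Proof.
elim: s => [|i s IH] h /=; first by rewrite !big_nil.
have [pf pg] := h i (mem_head _ _).
have hs j (js : j \in s) := h j (mem_behead (s := i :: s) js).
have {}IH := IH hs.
rewrite !big_cons; have pgs : mono (\big[op/idx]_(j <- s) g j).
  rewrite big_seq; apply: (big_ind mono) => // j js.
  by case: (hs j js).
case/predU1P => [fg|fg]; rewrite fg ?lt_irr /=.
  by case: ifP IH => _ IH; [exact: lt_op | rewrite IH].
have step : lt (op (f i) (\big[op/idx]_(j <- s) g j)) (op (g i) (\big[op/idx]_(j <- s) g j)).
  by rewrite ![op _ (bigop _ _ _)]Monoid.mulmC; apply: lt_op.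
case: ifP IH => _ IH; last by rewrite IH.
by apply: lt_trans step; apply: lt_op.
Qed.

Hypothesis end_lt : lt (end_term op F true) (end_term op F false).
Hypothesis pair_lt1 : lt (pair_term op F true true) (pair_term op F true false).
Hypothesis pair_lt0 : lt (pair_term op F true false) (pair_term op F false false).

(** The term of index [i.-1] sees the added turn as its last argument and strictly
    decreases, while no term increases. *)
Lemma turn_lowers_index m (k k' : nat -> bool) i : (forall j, k j ==> k' j) ->
  (0 < i < m.+2)%N -> ~~ k i -> k' i ->
  lt (\big[op/idx]_(0 <= j < m.+2) term op F m k' j)
     (\big[op/idx]_(0 <= j < m.+2) term op F m k j).
Proof.
move=> kk /andP[i0 im] ki k'i.
have pos_w a b : (0 < a)%N -> (0 < b)%N -> mono (weight F a b).
  by move=> a0 b0; apply: pos_F; rewrite ?addn_gt0 ?muln_gt0 a0.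
have pos_end a : mono (end_term op F a) by case: a; do !apply: pos_op; apply: pos_w.
have pos_pair a b : mono (pair_term op F a b).
  by case: a b => [] []; do !apply: pos_op; apply: pos_w.
have le_end a b : a ==> b -> le (end_term op F b) (end_term op F a).
  by case: a b => [] [] //=; rewrite /le ?eqxx ?end_lt ?orbT.
have lt_pair a b c : a ==> b ->
    le (pair_term op F b c) (pair_term op F a c) /\
    (~~ a -> b -> lt (pair_term op F b c) (pair_term op F a c)).
  case: a b c => [] [] [] //=; rewrite /le ?eqxx // ?pair_lt0 ?orbT //.
  by rewrite (pair_termC op F false) pair_lt1 orbT.
have le_trans : transitive le.
  move=> b a c /predU1P[->//|ab] /predU1P[<-|bc]; rewrite /le; first by rewrite ab orbT.
  by rewrite (lt_trans ab bc) orbT.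
have le_pair a b c d : a ==> b -> c ==> d ->
    le (pair_term op F b d) (pair_term op F a c).
  move=> ab cd; apply: le_trans (lt_pair a b c ab).1.
  by rewrite ![pair_term op F b _]pair_termC; apply: (lt_pair _ _ _ cd).1.
have := @lt_big _ (index_iota 0 m.+2) (term op F m k') (term op F m k).
case: hasP => [_|no]; first apply.
  move=> j _; rewrite /term; case: ifP => _; [|case: ifP => _]; split=> //; by [apply: le_end | apply: le_pair].
move=> _; exfalso; apply: no; exists i.-1; first by rewrite mem_index_iota; lia.
rewrite /term; case: i i0 im ki k'i => //= i _ im ki k'i.
case: eqP => [i0|_]; first by rewrite i0 in ki k'i; rewrite (negPf ki) k'i.
case: eqP => [|_]; first by lia.
have := (lt_pair (k i.+1) (k' i.+1) (k' i) (kk _)).2 ki k'i.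
rewrite ![pair_term op F _ (k' i)]pair_termC => h.
case/predU1P: (lt_pair (k i) (k' i) (k i.+1) (kk _)).1 => [<- //|].
exact: lt_trans.
Qed.

Variables (B L Z : sgraph) (m : nat) (kB fB kL fL kZ fZ : nat -> bool).
Variables (vB : label -> B) (vL : label -> L) (vZ : label -> Z).
Hypothesis ladB : ladder m.+3 kB fB vB.
Hypothesis regB : forall j, fB j -> ~~ kB j.-1.
Hypothesis ladL : ladder m.+3 kL fL vL.
Hypothesis straightL : forall j, ~~ kL j.
Hypothesis ladZ : ladder m.+3 kZ fZ vZ.
Hypothesis zigzagZ : forall j, (0 < j < m.+2)%N -> kZ j.

(** A flip prepares a turn. *)
Lemma straight_no_flip G n k f v :
  @ladder G n k f v -> (forall j, ~~ k j) -> f =1 xpred0.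
Proof. by move=> lad nk j; apply/negP=> /(ladder_flip lad)[_ _]; apply/negP. Qed.

(** A flip happens at a straight inner square. *)
Lemma zigzag_no_flip G p k f v : @ladder G p.+3 k f v ->
  (forall j, (0 < j < p.+2)%N -> k j) -> f =1 xpred0.
Proof.
move=> lad kk j; apply/negP=> /(ladder_flip lad)[j0 /negP nkj] /(ladder_turn lad) jn.
by apply/nkj/kk; lia.
Qed.

(** Either [B] has a turn, which separates its index from that of [L], or the two
    ladders have the same data; likewise for a missing turn and [Z]. *)
Lemma index_between :
  let I := edge_index op idx F in
  [/\ le (I Z) (I B), le (I B) (I L),
      I B = I L <-> isomorphic B L & I Z = I B <-> isomorphic B Z].
Proof.
move=> I.
have noL := straight_no_flip ladL straightL; have noZ := zigzag_no_flip ladZ zigzagZ.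
have IB : I B = _ := ladder_index op F ladB regB.
have regL j : fL j -> ~~ kL j.-1 by rewrite noL.
have IL : I L = _ := ladder_index op F ladL regL.
have regZ j : fZ j -> ~~ kZ j.-1 by rewrite noZ.
have IZ : I Z = _ := ladder_index op F ladZ regZ.
have kBP j : kB j -> (0 < j < m.+2)%N by move/(ladder_turn ladB).
have BL : isomorphic B L \/ lt (I B) (I L).
  case: (boolP (has kB (iota 0 m.+2))) => [/hasP[i _ ki]|/hasPn nk]; [right|left].
    rewrite IB IL; apply: (turn_lowers_index (i := i)); rewrite ?kBP // => j.
    by rewrite (negPf (straightL j)).
  have kB0 j : ~~ kB j.
    by apply/negP => kj; move: (nk j); rewrite kj mem_iota; have := kBP j kj; lia.
  apply: (ladder_isomorphic ladB ladL) => j; rewrite ?noL ?(straight_no_flip ladB) //.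
  by rewrite (negPf (kB0 j)) (negPf (straightL j)).
have ZB : isomorphic B Z \/ lt (I Z) (I B).
  case: (boolP (all kB (iota 1 m.+1))) => [/allP kall|/allPn[i im ki]]; [left|right].
    have kB1 j : (0 < j < m.+2)%N -> kB j by move=> jm; apply: kall; rewrite mem_iota.
    apply: (ladder_isomorphic ladB ladZ) => j; rewrite ?noZ ?(zigzag_no_flip ladB) //.
    by apply/idP/idP => [/kBP/zigzagZ|/(ladder_turn ladZ)/kB1].
  rewrite mem_iota in im; rewrite IB IZ; apply: (turn_lowers_index (i := i)) => //; last exact: zigzagZ.
  by move=> j; apply/implyP => /kBP/zigzagZ.
have eqI H1 H2 : isomorphic H1 H2 -> I H1 = I H2 by apply: edge_index_isomorphic.
split.
- by case: ZB => [/eqI->|h]; rewrite /le ?eqxx ?h ?orbT.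
- by case: BL => [/eqI->|h]; rewrite /le ?eqxx ?h ?orbT.
- split=> [E|/eqI //]; case: BL => // h; by rewrite E lt_irr in h.
- split=> [E|/eqI //]; case: ZB => // h; by rewrite E lt_irr in h.
Qed.

End Comparison.

(** * The five indices *)

(** The numerical condition for each added turn to move the index in the direction
    of [lt], whatever the neighbouring squares do. *)
Definition turning_decreases (T : Type) (idx : T) (op : Monoid.com_law idx)
    (F : nat -> nat -> T) (lt : rel T) : bool :=
  [&& lt (end_term op F true) (end_term op F false),
      lt (pair_term op F true true) (pair_term op F true false)
    & lt (pair_term op F true false) (pair_term op F false false)].

Section Numeric.
Variable R : realType.

Lemma sqrt_gt (a c : R) : 0 <= a -> a ^+ 2 < c -> a < Num.sqrt c.
Proof.
move=> a0 ac; rewrite -[ltLHS]ger0_norm // -sqrtr_sqr ltr_sqrt //.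
by apply: le_lt_trans ac; rewrite sqr_ge0.
Qed.

Lemma sqrt_lt (b c : R) : 0 < b -> c < b ^+ 2 -> Num.sqrt c < b.
Proof.
by move=> b0 cb; rewrite -[ltRHS]gtr0_norm // -sqrtr_sqr ltr_sqrt // exprn_gt0.
Qed.

Lemma inv_sqrt (c : R) : 0 <= c -> 1 / Num.sqrt c = Num.sqrt c^-1.
Proof. by move=> c0; rewrite div1r sqrtrV. Qed.

Definition GA_weight (s p : nat) : R := (2 * Num.sqrt p%:R) / s%:R.
Definition Randic_weight (s p : nat) : R := 1 / Num.sqrt p%:R.
Definition sum_weight (s p : nat) : R := 1 / Num.sqrt s%:R.

Lemma sqrt9 : Num.sqrt 9 = 3 :> R.
Proof. by rewrite (_ : 9 = 3 ^+ 2); [rewrite sqrtr_sqr ger0_norm | ring]. Qed.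

Lemma sqrt16 : Num.sqrt 16 = 4 :> R.
Proof. by rewrite (_ : 16 = 4 ^+ 2); [rewrite sqrtr_sqr ger0_norm | ring]. Qed.

Lemma GA_turning : turning_decreases +%R GA_weight <%R.
Proof.
have w24 : weight GA_weight 2 4 = 2 * Num.sqrt 8 / 6 by [].
have w34 : weight GA_weight 3 4 = 2 * Num.sqrt 12 / 7 by [].
have w23 : weight GA_weight 2 3 = 2 * Num.sqrt 6 / 5 by [].
have w33 : weight GA_weight 3 3 = 1.
  by change (2 * Num.sqrt 9 / 6 = 1 :> R); rewrite sqrt9; lra.
have w44 : weight GA_weight 4 4 = 1.
  by change (2 * Num.sqrt 16 / 8 = 1 :> R); rewrite sqrt16; lra.
(* the pair terms are about 2.886, 2.959 and 3 *)
have lo6 : 244 / 100 < Num.sqrt 6 :> R by apply: sqrt_gt; lra.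
have hi6 : Num.sqrt 6 < 25 / 10 :> R by apply: sqrt_lt; lra.
have hi8 : Num.sqrt 8 < 283 / 100 :> R by apply: sqrt_lt; lra.
have lo12 : 346 / 100 < Num.sqrt 12 :> R by apply: sqrt_gt; lra.
have hi12 : Num.sqrt 12 < 35 / 10 :> R by apply: sqrt_lt; lra.
rewrite /turning_decreases /end_term /pair_term ?addn0 ?subn0 ?addn1 ?subn1 /=.
rewrite ![weight _ 3 2]weightC ![weight _ 4 2]weightC ![weight _ 4 3]weightC.
rewrite w23 w24 w33 w34 w44; apply/and3P; split; lra.
Qed.

Lemma Randic_turning : turning_decreases +%R Randic_weight <%R.
Proof.
have w24 : weight Randic_weight 2 4 = Num.sqrt 8^-1 by exact: inv_sqrt.
have w34 : weight Randic_weight 3 4 = Num.sqrt 12^-1 by exact: inv_sqrt.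
have w23 : weight Randic_weight 2 3 = Num.sqrt 6^-1 by exact: inv_sqrt.
have w33 : weight Randic_weight 3 3 = 1 / 3 by rewrite /weight /Randic_weight sqrt9.
have w44 : weight Randic_weight 4 4 = 1 / 4 by rewrite /weight /Randic_weight sqrt16.
(* the pair terms are about 0.957, 0.986 and 1 *)
have lo6 : 408 / 1000 < Num.sqrt 6^-1 :> R by apply: sqrt_gt; lra.
have hi6 : Num.sqrt 6^-1 < 41 / 100 :> R by apply: sqrt_lt; lra.
have hi8 : Num.sqrt 8^-1 < 354 / 1000 :> R by apply: sqrt_lt; lra.
have lo12 : 288 / 1000 < Num.sqrt 12^-1 :> R by apply: sqrt_gt; lra.
have hi12 : Num.sqrt 12^-1 < 289 / 1000 :> R by apply: sqrt_lt; lra.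
rewrite /turning_decreases /end_term /pair_term ?addn0 ?subn0 ?addn1 ?subn1 /=.
rewrite ![weight _ 3 2]weightC ![weight _ 4 2]weightC ![weight _ 4 3]weightC.
rewrite w23 w24 w33 w34 w44; apply/and3P; split; lra.
Qed.

Lemma sum_turning : turning_decreases +%R sum_weight <%R.
Proof.
have w24 : weight sum_weight 2 4 = Num.sqrt 6^-1 by exact: inv_sqrt.
have w34 : weight sum_weight 3 4 = Num.sqrt 7^-1 by exact: inv_sqrt.
have w23 : weight sum_weight 2 3 = Num.sqrt 5^-1 by exact: inv_sqrt.
have w33 : weight sum_weight 3 3 = Num.sqrt 6^-1 by exact: inv_sqrt.
have w44 : weight sum_weight 4 4 = Num.sqrt 8^-1 by exact: inv_sqrt.
(* the pair terms are about 1.170, 1.203 and 1.225 *)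
have lo5 : 447 / 1000 < Num.sqrt 5^-1 :> R by apply: sqrt_gt; lra.
have hi5 : Num.sqrt 5^-1 < 448 / 1000 :> R by apply: sqrt_lt; lra.
have lo6 : 408 / 1000 < Num.sqrt 6^-1 :> R by apply: sqrt_gt; lra.
have hi6 : Num.sqrt 6^-1 < 41 / 100 :> R by apply: sqrt_lt; lra.
have hi8 : Num.sqrt 8^-1 < 354 / 1000 :> R by apply: sqrt_lt; lra.
have lo7 : 377 / 1000 < Num.sqrt 7^-1 :> R by apply: sqrt_gt; lra.
have hi7 : Num.sqrt 7^-1 < 378 / 1000 :> R by apply: sqrt_lt; lra.
rewrite /turning_decreases /end_term /pair_term ?addn0 ?subn0 ?addn1 ?subn1 /=.
rewrite ![weight _ 3 2]weightC ![weight _ 4 2]weightC ![weight _ 4 3]weightC.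
rewrite w23 w24 w33 w34 w44; apply/and3P; split; lra.
Qed.
End Numeric.

Lemma sum_Zagreb_turning : turning_decreases muln (fun s _ => s) gtn.
Proof. by []. Qed.

Lemma second_Zagreb_turning : turning_decreases muln (fun _ p => p) gtn.
Proof. by []. Qed.

(** * Extremal chains *)

Lemma omega_ladder (G : lattice_graph) n : (2 < n)%N -> Omega G n ->
  exists k f v, @ladder G n k f v /\ forall j, f j -> ~~ k j.-1.
Proof.
move=> n3 [C chain omega]; have [f [v [lad sqv]]] := chain_ladder chain n3.
by exists (turn n C), f, v; split=> // j; exact: (flip_regular chain lad sqv).
Qed.

Lemma linear_ladder (G : lattice_graph) n : (2 < n)%N -> linear_chain G n ->
  exists k f v, @ladder G n k f v /\ forall j, ~~ k j.
Proof.
move=> n3 [C chain straight]; have [f [v [lad sqv]]] := chain_ladder chain n3.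
exists (turn n C), f, v; split=> // j; apply/negP => Tj.
have [[jC _] _] := turn_kink chain lad sqv Tj.
exact: straight _ jC (turn_kink chain lad sqv Tj).
Qed.

Lemma zigzag_ladder (G : lattice_graph) n : (2 < n)%N -> zigzag_chain G n ->
  exists k f v, @ladder G n k f v /\ forall j, (0 < j < n.-1)%N -> k j.
Proof.
move=> n3 [C chain zigzag]; have [f [v [lad sqv]]] := chain_ladder chain n3.
exists (turn n C), f, v; split=> // j jn.
have jC : C`_j \in C by rewrite mem_nth // (chain_size chain); lia.
have [/(kink_turn lad sqv jn) //|[_]] := zigzag _ jC.
by rewrite (inner_degree chain jn).
Qed.

Unset Implicit Arguments.

Theorem corollary2p15 (R : realType) (n : nat) (B L Z : lattice_graph)
    (hn : (3 <= n)%N) (hB : Omega B n)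
    (hL : linear_chain L n) (hZ : zigzag_chain Z n) :
  (forall TI : sgraph -> R,
     TI = @GA_index R \/ TI = @Randic_index R
       \/ TI = @sum_connectivity_index R ->
     [/\ TI Z <= TI B <= TI L,
         TI B = TI L <-> isomorphic B L
       & TI Z = TI B <-> isomorphic B Z])
  /\
  [/\ (mult_sum_Zagreb L <= mult_sum_Zagreb B <= mult_sum_Zagreb Z)%N,
      mult_sum_Zagreb L = mult_sum_Zagreb B <-> isomorphic B L
    & mult_sum_Zagreb B = mult_sum_Zagreb Z <-> isomorphic B Z]
  /\
  [/\ (mult_second_Zagreb L <= mult_second_Zagreb B <= mult_second_Zagreb Z)%N,
      mult_second_Zagreb L = mult_second_Zagreb B <-> isomorphic B L
    & mult_second_Zagreb B = mult_second_Zagreb Z <-> isomorphic B Z].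
Proof.
have [kB [fB [vB [ladB regB]]]] := omega_ladder hn hB.
have [kL [fL [vL [ladL straightL]]]] := linear_ladder hn hL.
have [kZ [fZ [vZ [ladZ zigzagZ]]]] := zigzag_ladder hn hZ.
case: n hn {hB hL hZ} ladB ladL ladZ zigzagZ => [|[|[|m]]] // _ ladB ladL ladZ zigzagZ.
have real F : turning_decreases +%R F <%R -> let I := edge_index +%R (0 : R) F in
    [/\ I Z <= I B <= I L, I B = I L <-> isomorphic B L & I Z = I B <-> isomorphic B Z].
  case/and3P=> end_lt pair_lt1 pair_lt0 I.
  have [] := @index_between R 0 +%R F predT <%R ltxx lt_trans isT (fun _ _ _ _ => isT)
    (fun a b c _ ab => etrans (ltrD2l c a b) ab) (fun _ _ _ _ => isT)
    end_lt pair_lt1 pair_lt0 B L Z m _ _ _ _ _ _ _ _ _ ladB regB ladL straightL ladZ zigzagZ.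
  by rewrite -!le_eqVlt => -> ->.
have natural F : (forall a b, (0 < a)%N -> (0 < b)%N -> (0 < F a b)%N) ->
    turning_decreases muln F gtn -> let I := edge_index muln 1%N F in
    [/\ (I L <= I B <= I Z)%N, I L = I B <-> isomorphic B L & I B = I Z <-> isomorphic B Z].
  move=> F0 /and3P[end_lt pair_lt1 pair_lt0] I.
  have gtn_trans : transitive gtn by move=> b a c ab bc; exact: ltn_trans bc ab.
  have [ZB BL BLeq BZeq] := @index_between nat 1%N muln F (leq 1) gtn ltnn gtn_trans isT
    (fun a b a0 b0 => etrans (muln_gt0 a b) (introT andP (conj a0 b0)))
    (fun a b c c0 ba => etrans (ltn_pmul2l c0) ba) F0
    end_lt pair_lt1 pair_lt0 B L Z m _ _ _ _ _ _ _ _ _ ladB regB ladL straightL ladZ zigzagZ.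
  have leE x y : (y == x) || gtn y x -> (x <= y)%N by rewrite leq_eqVlt eq_sym.
  split; first by rewrite (leE _ _ BL) (leE _ _ ZB).
    by split=> [/esym/BLeq|/BLeq/esym].
  by split=> [/esym/BZeq|/BZeq/esym].
split; last first.
  split; first exact: (natural (fun s _ => s) (fun _ _ s0 _ => s0) sum_Zagreb_turning).
  exact: (natural (fun _ p => p) (fun _ _ _ p0 => p0) second_Zagreb_turning).
move=> TI [->|[->|->]].
- exact: real (GA_turning R).
- exact: real (Randic_turning R).
- exact: real (sum_turning R).
Qed.
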